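(* Let $\Omega\subset\mathbb{R}^N$, $N\ge2$, be a bounded domain with $C^{2,\alpha}$ boundary, let $f$ satisfy the standing assumptions (A) and $\lim_{s\to\sigma^+}f''(s)=+\infty$, and let $u$ be the minimizer of $J(v)=\int_\Omega[f(|\nabla v|)-v]\,dx$ over $W^{1,\infty}_0(\Omega)$. Assume there is a sequence $(f_n)$ of convex functions with $f_n(0)=0$, $f_n(s)/s\to\infty$ as $s\to\infty$, satisfying: (i) $f_n\in C^1([0,+\infty))\cap C^3((0,+\infty))$; (ii) $f_n\to f$ uniformly on compact subsets of $[0,+\infty)$; (iii) $f_n'(0)=0$, $f_n'$ decreases in $n$ to $f'$ and $f_n'\to f'$ uniformly on compact subsets of $[0,+\infty)$; (iv) $f_n''>0$ on $(0,+\infty)$; (v) $\lim_{s\to0^+}\frac{sf_n''(s)-f_n'(s)}{s^3}=0$ and $\lim_{s\to0^+}\frac{f_n'(s)}{s}=0$ for each $n$; (vi) $\lim_{n\to\infty}\frac{sf_n''(s)-f_n'(s)}{s^3}=0$ and $\lim_{n\to\infty}\frac{f_n'(s)}{s}=0$ uniformly on compact subsets of $[0,\sigma)$ (extended continuously by $0$ at $s=0$); (vii) $a_n\to a$ uniformly on compact subsets of $(0,+\infty)$ and $b_n\to b$ uniformly on compact subsets of $(\sigma,+\infty)$. Then $u$ is a viscosity solution in $\Omega$ of $$\min\Big(-[1-a(|\nabla u|)]\Delta_\infty u-|\nabla u|^2a(|\nabla u|)\Delta u-b(|\nabla u|),\ |\nabla u|-\sigma\Big)=0.$$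
   Context: Standing assumptions (A) on $f:[0,+\infty)\to\mathbb{R}$: $f$ convex, nondecreasing, and there is $\sigma>0$ with $f\in C^1([0,+\infty))\cap C^3((\sigma,+\infty))$; $f(0)=0$ and $\lim_{s\to+\infty}f(s)/s=+\infty$; $f'(s)=0$ for $0\le s\le\sigma$; $f''(s)>0$ for $s>\sigma$. Define $a(s)=\frac{f'(s)}{sf''(s)}$ and $b(s)=\frac{s^2}{f''(s)}$ for $s>\sigma$, and $a(s)=b(s)=0$ for $0\le s\le\sigma$; and $a_n(s)=\frac{f_n'(s)}{sf_n''(s)}$, $b_n(s)=\frac{s^2}{f_n''(s)}$ for $s>0$. $\Delta_\infty u=\sum_{i,j}\partial_{ij}u\,\partial_iu\,\partial_ju$. Viscosity solutions of $G(\nabla v,D^2v)=0$: an u.s.c. $w$ is a subsolution if for every $x_0\in\Omega$ and $\phi\in C^2(\Omega)$ with $w(x_0)=\phi(x_0)$, $w<\phi$ elsewhere, $G(\nabla\phi(x_0),D^2\phi(x_0))\le0$; an l.s.c. $w$ is a supersolution if for $\phi$ with $w(x_0)=\phi(x_0)$, $w>\phi$ elsewhere, $G(\nabla\phi(x_0),D^2\phi(x_0))\ge0$; a continuous $w$ is a solution if both. *)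

(* Defs.v *)
From HB Require Import structures.
From mathcomp Require Import all_boot all_order all_algebra.
From mathcomp Require Import all_classical all_reals all_analysis.
Set Implicit Arguments. Unset Strict Implicit. Unset Printing Implicit Defensive.
Import Order.TTheory GRing.Theory Num.Theory.
Import numFieldNormedType.Exports.
Local Open Scope classical_set_scope.
Local Open Scope ring_scope.

Section Defs.
Variable R : realType.

Definition convex_on (I : set R) (g : R -> R) : Prop :=
  forall x y t, I x -> I y -> 0 <= t -> t <= 1 ->
    g (t * x + (1 - t) * y) <= t * g x + (1 - t) * g y.

Definition nondecreasing_on (I : set R) (g : R -> R) : Prop :=
  forall x y, I x -> I y -> x <= y -> g x <= g y.

Definition C1_closed_halfline (g g1 : R -> R) : Prop :=
  (forall s : R, 0 < s -> is_derive s 1 g (g1 s)) /\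
  ((fun h => (g h - g 0) / h) @ 0^'+ --> g1 0) /\
  {within [set s | 0 <= s], continuous g1}.

(* g1 has derivative g2, g2 has derivative g3, g3 continuous, on the open
   set I: together with g1 = g', this says g is C^3 on I. *)
Definition C3_tail_on (I : set R) (g1 g2 g3 : R -> R) : Prop :=
  (forall s : R, I s -> is_derive s 1 g1 (g2 s)) /\
  (forall s : R, I s -> is_derive s 1 g2 (g3 s)) /\
  (forall s, I s -> {for s, continuous g3}).

Definition unif_cvg_on (g : nat -> R -> R) (h : R -> R) (K : set R) : Prop :=
  forall eps : R, 0 < eps ->
    \forall n \near \oo, forall s, K s -> `|g n s - h s| < eps.

Definition unif_cvg_compact (g : nat -> R -> R) (h : R -> R) (I : set R) : Prop :=
  forall K : set R, compact K -> K `<=` I -> unif_cvg_on g h K.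

Definition ext0 (g : R -> R) (s : R) : R := if s == 0 then 0 else g s.

(* a(s) = f'(s)/(s f''(s)), b(s) = s^2/f''(s) for s > sigma, 0 otherwise *)
Definition a_fun (sigma : R) (f1 f2 : R -> R) (s : R) : R :=
  if sigma < s then f1 s / (s * f2 s) else 0.
Definition b_fun (sigma : R) (f2 : R -> R) (s : R) : R :=
  if sigma < s then s ^+ 2 / f2 s else 0.
(* a_n, b_n, defined for s > 0 *)
Definition an_fun (f1 f2 : R -> R) (s : R) : R := f1 s / (s * f2 s).
Definition bn_fun (f2 : R -> R) (s : R) : R := s ^+ 2 / f2 s.

Variable N : nat.
Notation V := 'rV[R]_N.

(* Euclidean norm (the library norm on matrices is the sup norm) *)
Definition enorm (p : V) : R := Num.sqrt (\sum_(i < N) p 0 i ^+ 2).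

Definition ecoord (i : 'I_N) : V := delta_mx 0 i.

Definition pd (i : 'I_N) (g : V -> R) (x : V) : R := 'D_(ecoord i) g x.

Definition grad (g : V -> R) (x : V) : V := \row_i pd i g x.
Definition hess (g : V -> R) (x : V) : 'M[R]_N := \matrix_(i, j) pd i (pd j g) x.

Definition C2_on (O : set V) (g : V -> R) : Prop :=
  (forall x, O x -> {for x, continuous g}) /\
  (forall x i, O x -> derivable g x (ecoord i)) /\
  (forall x i j, O x -> derivable (pd j g) x (ecoord i)) /\
  (forall x i, O x -> {for x, continuous (pd i g)}) /\
  (forall x i j, O x -> {for x, continuous (pd i (pd j g))}).

Definition C2alpha_on (alpha : R) (O : set V) (g : V -> R) : Prop :=
  C2_on O g /\ exists C : R, forall x y i j, O x -> O y ->
    `|pd i (pd j g) x - pd i (pd j g) y| <= C * enorm (x - y) `^ alpha.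

Definition eball (x0 : V) (r : R) : set V := [set x | enorm (x - x0) < r].

Definition orthogonal_mx (Q : 'M[R]_N) : Prop := Q *m Q^T = 1%:M.

(* Omega has C^{2,alpha} boundary: near each boundary point, after a rigid
   motion y = (x - x0) Q, Omega is the supergraph {y_k > psi(y')} of a
   C^{2,alpha} function psi of the remaining coordinates y' (psi does not
   depend on y_k). *)
Definition C2alpha_boundary (alpha : R) (O : set V) : Prop :=
  forall x0, closure O x0 -> ~ O x0 ->
    exists r : R, 0 < r /\
    exists Q : 'M[R]_N, orthogonal_mx Q /\
    exists k : 'I_N, exists psi : V -> R,
      C2alpha_on alpha (eball 0 r) psi /\
      (forall y t, psi y = psi (y + t *: ecoord k)) /\
      (forall x, eball x0 r x ->
         (O x <-> psi ((x - x0) *m Q) < ((x - x0) *m Q) 0 k)).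

Definition bounded_domain (O : set V) : Prop :=
  open O /\ connected O /\ O !=set0 /\
  exists M : R, forall x, O x -> enorm x <= M.

(* W^{1,oo}_0(O), O bounded: Lipschitz functions vanishing outside O
   (i.e. Lipschitz on the closure, zero on the boundary, extended by 0) *)
Definition W1inf0 (O : set V) (v : V -> R) : Prop :=
  (exists L : R, forall x y, `|v x - v y| <= L * enorm (x - y)) /\
  (forall x, ~ O x -> v x = 0).

(* iterated Lebesgue integral over R^n (Fubini) *)
Fixpoint iint (n : nat) : ('rV[R]_n -> \bar R) -> \bar R :=
  match n return ('rV[R]_n -> \bar R) -> \bar R with
  | 0 => fun G => G 0
  | n'.+1 => fun G =>
      (\int[@lebesgue_measure R]_x iint (fun y : 'rV[R]_n' => G (row_mx x%:M y)))%E
  end.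

Definition Jfun (f : R -> R) (O : set V) (v : V -> R) : \bar R :=
  iint (fun x : V => (\1_O x * (f (enorm (grad v x)) - v x))%:E).

Definition visc_sub (O : set V) (G : V -> 'M[R]_N -> R) (w : V -> R) : Prop :=
  forall x0 (phi : V -> R), O x0 -> C2_on O phi -> w x0 = phi x0 ->
    (forall x, O x -> x <> x0 -> w x < phi x) ->
    G (grad phi x0) (hess phi x0) <= 0.
Definition visc_super (O : set V) (G : V -> 'M[R]_N -> R) (w : V -> R) : Prop :=
  forall x0 (phi : V -> R), O x0 -> C2_on O phi -> w x0 = phi x0 ->
    (forall x, O x -> x <> x0 -> w x > phi x) ->
    G (grad phi x0) (hess phi x0) >= 0.
Definition visc_solution (O : set V) (G : V -> 'M[R]_N -> R) (w : V -> R) : Prop :=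
  (forall x, O x -> {for x, continuous w}) /\ visc_sub O G w /\ visc_super O G w.

Definition inf_lap (p : V) (X : 'M[R]_N) : R :=
  \sum_(i < N) \sum_(j < N) X i j * p 0 i * p 0 j.

Definition Gop (sigma : R) (f1 f2 : R -> R) (p : V) (X : 'M[R]_N) : R :=
  let s := enorm p in
  Num.min (- (1 - a_fun sigma f1 f2 s) * inf_lap p X
           - s ^+ 2 * a_fun sigma f1 f2 s * \tr X - b_fun sigma f2 s)
          (s - sigma).

End Defs.

(* Main.v *)
(* Comparing [u] with a competitor that follows the touching test function [phi]
   replaces all regularity theory. Let [tau = 1] when [phi] touches [u] from above
   and [tau = -1] when it touches from below. On a small cube around the contact
   point put [z = tau max(0, tau (u - phi) + eps)], which vanishes near the
   boundary of the cube, and let [v = u - z]; where [z <> 0], [v] is [phi] up to a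
   constant, and where [z = 0] and [z] is differentiable its gradient vanishes.
   By convexity [f(|Du|) >= f(|Dv|) + F . Dz] almost everywhere, where
   [F = f'(|Dphi|) Dphi / |Dphi|], and integrating by parts
     [J(u) - J(v) >= - \int (div F + 1) z].
   If [phi] violated the viscosity inequality at the contact point, the right-hand
   side would be positive, against minimality. When [|Dphi| < sigma] one takes
   [F = 0]. When [|Dphi| = sigma] at the contact point, [F] is not differentiable;
   there one uses [F_n] built from [f_n], for which [a_n <= 1] and [Delta_oo phi > 0]
   give [div F_n >= - 1/2], at the price of an error that tends to [0] with [n].

   The integration by parts needs only that a Lipschitz function on a line is
   differentiable almost everywhere and is the integral of its derivative: up to
   normalisation it is the distribution function of a probability measure dominated
   by Lebesgue measure, whose Radon-Nikodym density is the derivative. *)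
Require Import Defs.
From HB Require Import structures.
From mathcomp Require Import all_boot all_order all_algebra.
From mathcomp Require Import all_classical all_reals all_analysis.
From mathcomp Require Import measurable_realfun ring lra.
Set Implicit Arguments. Unset Strict Implicit. Unset Printing Implicit Defensive.
Import Order.TTheory GRing.Theory Num.Theory.
Import numFieldNormedType.Exports.
Local Open Scope classical_set_scope.
Local Open Scope ring_scope.

(** * Lipschitz functions on the line *)

(** The order of choices carries the argument. The competitor is built from [u], [phi] and a fixed
    radius alone, so the integral of [|z|] is fixed before the field [F] and the error [delta] are
    chosen; minimality then yields [c * \int |z| <= delta * vol] for every [delta > 0], with the
    same [c]. An approximate calibration is therefore as good as an exact one. This matters when
    [|Dphi| = sigma]: [f''] blows up on the right of [sigma] while [f'] is [0] on the left. Only the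
    gradients of the Lipschitz function [u] have to be tested against the field, and these are
    bounded, so uniform closeness of [f_n'] to [f'] on one compact interval suffices. Minimizers for
    [f_n] never appear. Two features of the definitions shape the measure theory. [pd] is a limit
    that takes the default value [point] where it does not exist, so bounds on [pd] carry [|point|],
    and the set of bad points must be shown measurable and null. [Jfun] is an iterated integral in a
    fixed order, so integrating first along an arbitrary coordinate requires the product measure. *)

Section clamp.
Context {R : realType}.
Implicit Types a b t s : R.

(** Nearest-point projection onto [[a, b]]. It normalises Lipschitz functions on the line and,
    applied to each coordinate, projects space onto a cube. *)
Definition clamp a b t : R := Num.max a (Num.min t b).

Lemma clamp_ge a b t : a <= clamp a b t.
Proof. by rewrite /clamp le_max lexx. Qed.

Lemma clamp_le a b t : a <= b -> clamp a b t <= b.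
Proof. by move=> ab; rewrite /clamp ge_max ab ge_min lexx orbT. Qed.

Lemma clamp_id a b t : a <= t -> t <= b -> clamp a b t = t.
Proof. by move=> at_ tb; rewrite /clamp min_l// max_r. Qed.

Lemma clamp_below a b t : a <= b -> t <= a -> clamp a b t = a.
Proof. by move=> ab ta; rewrite /clamp max_l// ge_min ta. Qed.

Lemma clamp_above a b t : a <= b -> b <= t -> clamp a b t = b.
Proof. by move=> ab bt; rewrite /clamp min_r// max_r. Qed.

Lemma clamp_nd a b t s : a <= b -> t <= s ->
  0 <= clamp a b s - clamp a b t <= s - t.
Proof.
move=> ab ts; have [ta|at_] := leP t a; have [sa|as_] := leP s a.
- by rewrite !clamp_below//; apply/andP; split; lra.
- rewrite (@clamp_below _ _ t)//; have [sb|bs] := leP s b.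
    by rewrite clamp_id ?(ltW as_)//; apply/andP; split; lra.
  by rewrite clamp_above ?(ltW bs)//; apply/andP; split; lra.
- by apply/andP; split; lra.
- have [tb|bt] := leP t b; have [sb|bs] := leP s b.
  + rewrite (clamp_id (ltW at_) tb) (clamp_id (ltW as_) sb).
    by apply/andP; split; lra.
  + rewrite (@clamp_id _ _ t) ?(ltW at_)// (@clamp_above _ _ s) ?(ltW bs)//.
    by apply/andP; split; lra.
  + by apply/andP; split; lra.
  + rewrite (clamp_above ab (ltW bt)) (clamp_above ab (ltW bs)).
    by apply/andP; split; lra.
Qed.

Lemma clamp_lip a b t s : a <= b -> `|clamp a b t - clamp a b s| <= `|t - s|.
Proof.
move=> ab; have [ts|/ltW st] := leP t s.
  rewrite distrC (distrC t); have := clamp_nd ab ts => /andP[? ?].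
  by rewrite !ger0_norm//; lra.
have := clamp_nd ab st => /andP[? ?].
by rewrite !ger0_norm//; lra.
Qed.

End clamp.

Section lipschitz_line.
Context {R : realType}.
Local Notation mu := (@lebesgue_measure R).
Variables (g : R -> R) (K L : R).
Hypotheses (K1 : 1 <= K) (L1 : 1 <= L).
Hypothesis glip : forall x y, `|g x - g y| <= L * `|x - y|.
Hypothesis gsupp : forall x, K <= `|x| -> g x = 0.

Let c := clamp (- K) K.
Let KK : - K <= K. Proof. have := K1; lra. Qed.

(** As [g] vanishes at [K] and [- K] and beyond, clamping does not change it. Hence its increments
    are at most [L] times those of [c]. *)
Let gc x : g x = g (c x).
Proof.
have k1 := K1; rewrite /c; have [xK|Kx] := leP x (- K).
  by rewrite clamp_below// !gsupp// ?normrN ?ler_norm// ler0_norm//; lra.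
have [xK|xK] := leP x K; first by rewrite clamp_id// ltW.
by rewrite clamp_above ?(ltW xK)// !gsupp// ?ler_norm// ger0_norm//; lra.
Qed.

(* The affine normalisation turning [g] into the distribution function of a
   probability measure dominated by Lebesgue measure. *)
Definition lip_cdf (x : R) : R := (g x + L * c x + L * K) / (2 * L * K).
Local Notation m := lip_cdf.

Let LK0 : 0 < 2 * L * K.
Proof. by have := L1; have := K1 => k l; rewrite !mulr_gt0//; lra. Qed.

Let K0 : K != 0. Proof. by rewrite gt_eqF// (lt_le_trans ltr01). Qed.
Let L0 : L != 0. Proof. by rewrite gt_eqF// (lt_le_trans ltr01). Qed.

(** [g + L * c] has slope between [0] and [2 * L]; after division by [2 * L * K] with [1 <= K] the
    slope is at most [1], which later gives domination by Lebesgue measure. *)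
Let m_incr x y : x <= y -> 0 <= m y - m x <= y - x.
Proof.
move=> xy; have /andP[c0 c1] := clamp_nd KK xy.
rewrite -/c in c0 c1.
have gg : `|g y - g x| <= L * (c y - c x).
  by rewrite gc (gc x) (le_trans (glip _ _))// ger0_norm.
move: gg; rewrite ler_norml => /andP[g1 g2].
have -> : m y - m x = (g y - g x + L * (c y - c x)) / (2 * L * K).
  by rewrite /m; field; rewrite K0 L0.
apply/andP; split; first by apply: divr_ge0; [lra|exact: ltW].
rewrite ler_pdivrMr//.
apply: (@le_trans _ _ (2 * L * (c y - c x))); first lra.
have -> : (y - x) * (2 * L * K) = 2 * L * ((y - x) * K) by ring.
have := L1 => l; rewrite ler_wpM2l//; first lra.
by rewrite (le_trans c1)// ler_peMr//; lra.
Qed.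

Let m_nd : {homo m : x y / x <= y}.
Proof. by move=> x y /m_incr/andP[+ _]; rewrite subr_ge0. Qed.

Let m_lip x y : `|m x - m y| <= `|x - y|.
Proof.
have [xy|/ltW yx] := leP x y.
  by rewrite distrC (distrC x); have /andP[? ?] := m_incr xy; rewrite !ger0_norm//; lra.
by have /andP[? ?] := m_incr yx; rewrite !ger0_norm//; lra.
Qed.

Let m_continuous : continuous m.
Proof.
move=> x; apply/cvgrPdist_lt => e e0.
by exists e => //= y /=; exact: le_lt_trans (m_lip _ _).
Qed.

Let m_lo (x : R) : x <= - K -> m x = 0.
Proof.
move=> xK; rewrite /m gsupp; last first.
  by have := K1 => k; rewrite ler0_norm//; lra.
by rewrite /c clamp_below// add0r mulrN addNr mul0r.
Qed.

Let m_hi x : K <= x -> m x = 1.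
Proof.
move=> xK; rewrite /m gsupp; last first.
  by have := K1 => k; rewrite ger0_norm//; lra.
rewrite /c clamp_above// add0r; field.
by rewrite K0 L0.
Qed.

Let m_Ny : m @ -oo --> (0 : R).
Proof.
apply: cvg_near_cst; exists (- K); split; first exact: num_real.
by move=> x /ltW; exact: m_lo.
Qed.

Let m_y : m @ +oo --> (1 : R).
Proof.
apply: cvg_near_cst; exists K; split; first exact: num_real.
by move=> x /ltW; exact: m_hi.
Qed.

HB.instance Definition _ := isCumulative.Build R _ R m m_nd
  (right_continuousW m_continuous).
HB.instance Definition _ := isCumulativeBounded.Build R 0 1 m m_Ny m_y.

(** Its Stieltjes measure is what must be added to that of [m] to obtain Lebesgue measure; being a
    nonnegative measure, it witnesses the domination. *)
Definition lip_cdf_compl (x : R) : R := x - m x.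
Local Notation m' := lip_cdf_compl.

Let m'_nd : {homo m' : x y / x <= y}.
Proof. by move=> x y /m_incr/andP[_ +]; rewrite /m'; lra. Qed.

Let m'_continuous : continuous m'.
Proof.
move=> x; apply: cvgB; [exact: cvg_id|exact: m_continuous].
Qed.

HB.instance Definition _ := isCumulative.Build R _ R m' m'_nd
  (right_continuousW m'_continuous).

Let stieltjes_oc (f : cumulative R R) (a b : R) : a <= b ->
  lebesgue_stieltjes_measure f `]a, b]%classic = (f b - f a)%:E.
Proof.
move=> ab; rewrite /lebesgue_stieltjes_measure /measure_extension.
by rewrite measurable_mu_extE/= ?wlength_itv_bnd//; exact: is_ocitv.
Qed.

Lemma lip_cdf_probability : exists P : probability (measurableTypeR R) R,
  (forall a b : R, a <= b -> P `]a, b]%classic = (m b - m a)%:E) /\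
  (forall A, measurable A -> (P A <= mu A)%E).
Proof.
pose P : probability (measurableTypeR R) R := lebesgue_stieltjes_measure m.
exists P; have Poc (a b : R) : a <= b -> P `]a, b]%classic = (m b - m a)%:E.
  exact: stieltjes_oc.
split => // A mA.
pose P' : {measure set (measurableTypeR R) -> \bar R} := lebesgue_stieltjes_measure m'.
have P'oc (a b : R) : a <= b -> P' `]a, b]%classic = (m' b - m' a)%:E.
  exact: stieltjes_oc.
have -> : mu A = measure_add P P' A.
  rewrite /lebesgue_measure.
  apply: lebesgue_stieltjes_measure_unique => // X [[a b] _ <-] /=.
  rewrite [RHS]measure_addE; have [ab|ba] := leP a b.
    rewrite [LHS]stieltjes_oc//.
    transitivity ((m b - m a)%:E + (m' b - m' a)%:E)%E.
      by rewrite -EFinD; congr EFin; rewrite /m' /=; lra.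
    by congr (_ + _)%E; [exact/esym/Poc|exact/esym/P'oc].
  by rewrite set_itv_ge ?bnd_simp -?leNgt ?(ltW ba)// !measure0 adde0.
by rewrite measure_addE leeDl.
Qed.

Section cdf_probability.
Variable P : probability (measurableTypeR R) R.
Hypothesis P_oc : forall a b : R, a <= b -> P `]a, b]%classic = (m b - m a)%:E.
Hypothesis P_dom : forall A, measurable A -> (P A <= mu A)%E.

Let P_null : P `<< mu.
Proof.
apply/null_content_dominatesP => A mA A0; apply/eqP; rewrite eq_le measure_ge0.
by rewrite andbT -A0 P_dom.
Qed.

Let P_out : P (~` `]- K, K]%classic) = 0%E.
Proof.
by rewrite probability_setC// P_oc// m_hi// m_lo// subr0 subee.
Qed.

Let P_Ny (x : R) : P `]-oo, x]%classic = (m x)%:E.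
Proof.
have P0 (y : R) : y <= - K -> P `]-oo, y]%classic = 0%E.
  move=> yK; apply/eqP; rewrite eq_le measure_ge0 andbT -P_out.
  apply: le_measure; rewrite ?inE//; first exact: measurableC.
  by move=> z /=; rewrite !in_itv/= => zy; apply/negP; rewrite negb_and; lra.
have [xK|Kx] := leP x (- K); first by rewrite P0// m_lo.
have -> : `]-oo, x]%classic = `]-oo, - K]%classic `|` `]- K, x]%classic.
  by rewrite -itv_bndbnd_setU// bnd_simp ltW.
rewrite measureU//; last first.
  by rewrite -subset0 => z /=; rewrite !in_itv/= => -[zK /andP[Kz _]]; lra.
transitivity (0 + (m x - m (- K))%:E)%E; last by rewrite add0e (@m_lo (- K))// subr0.
by congr (_ + _)%E; [exact: P0|apply: P_oc; exact: ltW].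
Qed.

Let c_derive (x : R) : x != - K -> x != K -> is_derive x (1 : R) c (\1_`[- K, K] x).
Proof.
move=> xK1 xK2; rewrite indicE.
have [xK|xK] := ltP x (- K).
  have -> : (x \in `[- K, K]%classic) = false.
    by apply/negP; rewrite inE /= in_itv/= => /andP[]; lra.
  apply: (near_eq_is_derive _ (is_derive_cst (- K) _ _)) => //.
  near=> y; rewrite /c clamp_below//.
  by apply: ltW; near: y; exact: lt_nbhsl.
have {}xK : - K < x by rewrite lt_neqAle eq_sym xK1.
have [Kx|Kx] := ltP K x.
  have -> : (x \in `[- K, K]%classic) = false.
    by apply/negP; rewrite inE /= in_itv/= => /andP[]; lra.
  apply: (near_eq_is_derive _ (is_derive_cst K _ _)) => //.
  near=> y; rewrite /c clamp_above//.
  by apply: ltW; near: y; exact: lt_nbhsr.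
have {}Kx : x < K by rewrite lt_neqAle xK2.
have -> : (x \in `[- K, K]%classic) = true.
  by apply: mem_set; rewrite /= in_itv/= !ltW.
apply: (near_eq_is_derive _ (is_derive_id _ _)) => //.
near=> y; rewrite /c clamp_id//.
- by apply: ltW; near: y; exact: lt_nbhsr.
- by apply: ltW; near: y; exact: lt_nbhsl.
Unshelve. all: by end_near. Qed.

Lemma lipschitz_density_subproof : exists h : R -> R,
  [/\ mu.-integrable setT (EFin \o h),
      {ae mu, forall x : R, is_derive x (1 : R) g (h x)} &
      (\int[mu]_x (h x)%:E = 0)%E].
Proof.
have [d [d0 dfin intd dE]] := radon_nikodym_sigma_finite P_null.
pose d' := fine \o d.
have dd' : EFin \o d' = d by apply/funext => x; rewrite /= fineK.
have intd' : mu.-integrable setT (EFin \o d') by rewrite dd'.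
have PE (x : R) : (\int[mu]_(t in `]-oo, x]) (d' t))%R = m x.
  rewrite /Rintegral.
  under eq_integral do rewrite -[(d' _)%:E]/((EFin \o d') _) dd'.
  by have := P_Ny x; rewrite dE// => ->.
(* The definition of [m], solved for [g], reads [g = 2 * L * K * m - L * c - L * K]. Almost
   everywhere [m] has derivative [d'], and [c] has the indicator as derivative off the two
   endpoints. The integral of [h] is [2 * L * K * 1 - L * (2 * K) = 0]. *)
pose h x := 2 * L * K * d' x - L * \1_`[- K, K] x.
have intI : mu.-integrable setT (EFin \o \1_(`[- K, K]%classic : set R)).
  exact: integrable_indic_itv.
have int1 := integrableZl measurableT (2 * L * K) intd'.
have int2 := integrableZl measurableT L intI.
exists h; split.
- by have := integrableB measurableT int1 int2; apply: eq_integrable.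
- have intdy (y : R) : mu.-integrable `]-oo, y] (EFin \o d').
    by apply: integrableS intd' => //; exact: measurable_itv.
  have := FTC1Ny intdy (open_integrable_locally openT intd').
  have n1 : \forall x \ae mu, x != - K.
    by exists [set - K]; split => //=; [rewrite lebesgue_measure_set1|move=> x /= /negP; rewrite negbK => /eqP].
  have n2 : \forall x \ae mu, x != K.
    by exists [set K]; split => //=; [rewrite lebesgue_measure_set1|move=> x /= /negP; rewrite negbK => /eqP].
  rewrite /= (_ : (fun x => _) = m); last by apply/funext => y; rewrite PE.
  move=> H; have FF := ae_filter_ringOfSetsType mu.
  apply: filterS3 H n1 n2 => x [H1 H2] xK1 xK2.
  have dm : is_derive x 1 m (d' x) by apply: DeriveDef => //; rewrite -derive1E.
  have dc := c_derive xK1 xK2.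
  have -> : g = (2 * L * K \*: m) - (L \*: c) - cst (L * K).
    apply/funext => y; rewrite !fctE/= /m /GRing.scale/=; field.
    by rewrite L0 K0.
  by apply: is_derive_eq; rewrite subr0.
- transitivity (\int[mu]_x (((2 * L * K)%:E * (d' x)%:E) - (L%:E * (\1_`[- K, K] x)%:E)))%E.
    by [].
  rewrite integralB// !integralZl//.
  have -> : (\int[mu]_x (d' x)%:E = 1)%E.
    under eq_integral do rewrite -[(d' _)%:E]/((EFin \o d') _) dd'.
    by rewrite -dE// [LHS]probability_setT.
  have -> : (\int[mu]_x (\1_`[- K, K] x)%:E = (K - - K)%:E)%E.
    rewrite integral_indic// setIT; have := lebesgue_measure_itv `[- K, K].
    by rewrite /= lte_fin (_ : - K < K) => [->//|]; have := K1; lra.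
  by rewrite -!EFinM -EFinB; congr EFin; ring.
Qed.

End cdf_probability.

Lemma lipschitz_density : exists h : R -> R,
  [/\ mu.-integrable setT (EFin \o h),
      {ae mu, forall x : R, is_derive x (1 : R) g (h x)} &
      (\int[mu]_x (h x)%:E = 0)%E].
Proof.
by have [P [P1 P2]] := lip_cdf_probability; exact: lipschitz_density_subproof P1 P2.
Qed.

End lipschitz_line.

(** * The iterated Lebesgue integral *)

Section iterated_space.
Context {R : realType}.
Local Notation leb := (@lebesgue_measure R).

(** Type and measure are bundled because each step of the recursion [Rspace] needs the measurable
    structure and the sigma-finite measure of the step before. *)
Record mspace := MSpace {
  ms_disp : measure_display;
  ms_type : measurableType ms_disp;
  ms_measure : {sigma_finite_measure set ms_type -> \bar R} }.

Definition leb_sigma_finite : {sigma_finite_measure set (measurableTypeR R) -> \bar R} := leb.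

(* The library instance is shadowed by the one for subprobabilities. *)
Lemma prod_leb_sigma_finite (m : mspace) :
  sigma_finite setT (leb_sigma_finite \x ms_measure m)%E.
Proof.
have /sigma_finiteP[F [TF ndF Foo]] := sigma_finiteT leb_sigma_finite.
have /sigma_finiteP[G [TG ndG Goo]] := sigma_finiteT (ms_measure m).
exists (fun k => F k `*` G k) => [|k].
  apply/seteqP; split => // -[x y] _.
  have : setT x by []. have : setT y by [].
  rewrite TF TG => -[j _ Gy] [i _ Fx]; exists (maxn i j) => //; split => /=.
    by apply: (subsetPset _ _ (ndF _ _ (leq_maxl i j))).
  by apply: (subsetPset _ _ (ndG _ _ (leq_maxr i j))).
have [mF F1] := Foo k; have [mG G1] := Goo k; split; first exact: measurableX.
by rewrite product_measure1E// lte_mul_pinfty// ge0_fin_numE.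
Qed.

Definition prod_leb (m : mspace) :
    {sigma_finite_measure set (measurableTypeR R * ms_type m)%type -> \bar R} :=
  HB.pack (leb_sigma_finite \x ms_measure m)%E
    (Measure_isSigmaFinite.Build _ _ _ (leb_sigma_finite \x ms_measure m)%E
      (prod_leb_sigma_finite m)).

Definition unit_dirac : {sigma_finite_measure set unit -> \bar R} := @dirac _ unit tt R.

(** Nested pairs with the first coordinate outermost, the order in which [iint] peels off variables;
    this makes induction on the dimension possible. *)
Fixpoint Rspace (n : nat) : mspace :=
  if n is n'.+1 then MSpace (prod_leb (Rspace n')) else MSpace unit_dirac.

Definition Rn n := ms_type (Rspace n).
Definition mun n : {sigma_finite_measure set (Rn n) -> \bar R} :=
  ms_measure (Rspace n).

Fixpoint toV n : Rn n -> 'rV[R]_n :=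
  match n return Rn n -> 'rV[R]_n with
  | 0 => fun _ => 0
  | n'.+1 => fun p : R * Rn n' => row_mx p.1%:M (toV p.2)
  end.

Lemma toV_surj n (x : 'rV[R]_n) : exists p, toV p = x.
Proof.
elim: n x => [|n IH] x; first by exists tt; rewrite [RHS]thinmx0.
have [p pE] := IH (@rsubmx _ _ 1 n x).
exists (x 0 0, p); rewrite /= pE; apply/rowP => j.
rewrite mxE; case: splitP => k jk.
  by rewrite mxE (ord1 k) eqxx mulr1n; congr (x _ _); apply/val_inj; rewrite /= jk (ord1 k).
by rewrite mxE; congr (x _ _); apply/val_inj; rewrite /= jk.
Qed.

Lemma toV_ord0 n (p : Rn n.+1) : toV p 0 ord0 = p.1.
Proof. by rewrite /= mxE; case: splitP => // k _; rewrite mxE (ord1 k) eqxx. Qed.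

Lemma toV_lift n (p : Rn n.+1) (i : 'I_n) : toV p 0 (lift ord0 i) = toV p.2 0 i.
Proof.
rewrite /= mxE; case: splitP => k /=; first by rewrite (ord1 k).
by rewrite /bump/= add1n => -[ik]; congr (toV _ _ _); apply/val_inj.
Qed.

Lemma measurable_toV n (i : 'I_n) : measurable_fun setT (fun p : Rn n => toV p 0 i).
Proof.
elim: n i => [[]//|n IH] i.
case: (unliftP ord0 i) => [j|] ->.
  apply: (eq_measurable_fun (fun p : R * Rn n => toV p.2 0 j)).
    by move=> p _; rewrite toV_lift.
  exact: measurableT_comp (IH j) measurable_snd.
apply: (eq_measurable_fun (fun p : R * Rn n => p.1)).
  by move=> p _; rewrite toV_ord0.
exact: measurable_fst.
Qed.

(** Counterpart of [upd] on nested pairs. The index is a plain natural number so that the recursion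
    needs no ordinal casts. *)
Fixpoint updT n (i : nat) (t : R) : Rn n -> Rn n :=
  match n return Rn n -> Rn n with
  | 0 => id
  | n'.+1 => fun p : R * Rn n' =>
      if i is i'.+1 then (p.1, updT i' t p.2) else (t, p.2)
  end.

Definition upd n (i : 'I_n) (t : R) (x : 'rV[R]_n) : 'rV[R]_n :=
  \row_j (if j == i then t else x 0 j).

Lemma updE n (i : 'I_n) t x j : upd i t x 0 j = if j == i then t else x 0 j.
Proof. by rewrite mxE. Qed.

Lemma toV_updT n (i : 'I_n) t p : toV (updT i t p) = upd i t (toV p).
Proof.
elim: n i p => [[]//|n IH] i p; apply/rowP => j.
case: (unliftP ord0 i) => [i'|] ->; case: (unliftP ord0 j) => [j'|] ->.
- by rewrite [LHS]toV_lift [updT]lock /= -lock IH !updE (inj_eq lift_inj) toV_lift.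
- by rewrite [LHS]toV_ord0 updE toV_ord0.
- by rewrite [LHS]toV_lift updE toV_lift.
- by rewrite [LHS]toV_ord0 updE eqxx.
Qed.

(* Tonelli lets the i-th coordinate be integrated first. *)
Lemma eq_integral_lines n (i : 'I_n) (G1 G2 : Rn n -> \bar R) :
  measurable_fun setT G1 -> measurable_fun setT G2 ->
  (forall p, (0 <= G1 p)%E) -> (forall p, (0 <= G2 p)%E) ->
  (forall p, (\int[leb]_t G1 (updT i t p) = \int[leb]_t G2 (updT i t p))%E) ->
  (\int[mun n]_p G1 p = \int[mun n]_p G2 p)%E.
Proof.
elim: n i G1 G2 => [[]//|n IH] i G1 G2 mG1 mG2 G10 G20.
case: (unliftP ord0 i) => [j|] -> H.
  rewrite /mun /= !fubini_tonelli1//.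
  apply: eq_integral => x _; rewrite /fubini_F.
  apply: (IH j) => //.
  - by apply: measurableT_comp mG1 _; exact: pair1_measurable.
  - by apply: measurableT_comp mG2 _; exact: pair1_measurable.
  - by move=> p; have := H (x, p).
rewrite /mun /= !fubini_tonelli2//.
by apply: eq_integral => y _; rewrite /fubini_G; have := H (0, y).
Qed.

Fixpoint boxT n (r : R) : Rn n -> set (Rn n) :=
  match n return Rn n -> set (Rn n) with
  | 0 => fun _ => setT
  | n'.+1 => fun p0 : R * Rn n' =>
     `[p0.1 - r, p0.1 + r]%classic `*` boxT r p0.2
  end.

Lemma boxTP n r (p0 p : Rn n) :
  boxT r p0 p <-> forall i, `|toV p 0 i - toV p0 0 i| <= r.
Proof.
elim: n p0 p => [|n IH] p0 p; first by split => // _ [].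
split.
  move=> [/= h1 /IH h2] i; case: (unliftP ord0 i) => [j|] ->.
    by rewrite !toV_lift.
  by rewrite !toV_ord0; move: h1; rewrite in_itv/= ler_distl.
move=> H; split => /=.
  by have := H ord0; rewrite !toV_ord0 in_itv/= ler_distl.
by apply/IH => i; have := H (lift ord0 i); rewrite !toV_lift.
Qed.

Lemma measurable_boxT n r (p0 : Rn n) : measurable (boxT r p0).
Proof.
elim: n p0 => [|n IH] p0; first exact: measurableT.
by apply: measurableX => //; exact: measurable_itv.
Qed.

Lemma mun_boxT n r (p0 : Rn n) : 0 < r -> mun n (boxT r p0) = ((2 * r) ^+ n)%:E.
Proof.
move=> r0; elim: n p0 => [|n IH] p0; first by rewrite /mun/= diracT.
have -> : mun n.+1 (boxT r p0) =
    (leb [set` `[p0.1 - r, p0.1 + r]%R] * mun n (boxT r p0.2))%E.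
  apply: product_measure1E; first exact: measurable_itv.
  exact: measurable_boxT.
rewrite IH [X in (X * _)%E](lebesgue_measure_itv `[p0.1 - r, p0.1 + r])/= lte_fin.
rewrite (_ : p0.1 - r < p0.1 + r); last by lra.
by rewrite -EFinD -EFinM exprS; congr EFin; ring.
Qed.

Lemma measurable_countable_fibres d (T : measurableType d) (C : countType)
    (q : T -> C) (F : C -> R) :
  (forall c, measurable [set x | q x = c]) -> measurable_fun setT (F \o q).
Proof.
move=> mq _ B mB; rewrite setTI.
rewrite (_ : _ @^-1` B = \bigcup_(c in [set c | B (F c)]) [set x | q x = c]); last first.
  by apply/seteqP; split => [x /= BF|x [c /= Bc qx]]; [exists (q x)|rewrite /= qx].
rewrite bigcup_mkcond; apply: countable_bigcupT_measurable => // c.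
by case: ifP.
Qed.

Definition floorV n (k : nat) (x : 'rV[R]_n) : 'rV[int]_n :=
  \row_j Num.floor (k.+1%:R * x 0 j).

Definition gridV n (k : nat) (z : 'rV[int]_n) : 'rV[R]_n :=
  \row_j ((z 0 j)%:~R / k.+1%:R).

Lemma cvg_gridV n (x : 'rV[R]_n) : gridV k (floorV k x) @[k --> \oo] --> x.
Proof.
apply/cvgrPdist_le => e e0; near=> k.
rewrite /Num.norm/= mx_normrE; apply: bigmax_le => [|/= [i j] _]; first exact: ltW.
rewrite (ord1 i) !mxE /=.
have k0 : 0 < k.+1%:R :> R by [].
have -> : x 0 j - (Num.floor (k.+1%:R * x 0 j))%:~R / k.+1%:R =
  (k.+1%:R * x 0 j - (Num.floor (k.+1%:R * x 0 j))%:~R) / k.+1%:R.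
  by field; rewrite gt_eqF.
rewrite normrM (@gtr0_norm _ k.+1%:R^-1) ?invr_gt0//.
rewrite ler_pdivrMr//.
apply: (@le_trans _ _ 1).
  have /andP[] := floor_itv (k.+1%:R * x 0 j); rewrite intrD => f1 f2.
  by rewrite ger0_norm; lra.
rewrite -ler_pdivrMl// mulr1.
rewrite (@le_trans _ _ k%:R)// ?ler_nat//.
by near: k; exact: nbhs_infty_ger.
Unshelve. all: by end_near. Qed.

Lemma measurable_floorV n k (z : 'rV[int]_n) :
  measurable [set p : Rn n | floorV k (toV p) = z].
Proof.
rewrite (_ : [set _ | _] = \bigcap_(j in [set: 'I_n])
    [set p | Num.floor (k.+1%:R * toV p 0 j) = z 0 j]); last first.
  apply/seteqP; split => [p /= <- j _ /=|p /= H]; first by rewrite mxE.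
  by apply/rowP => j; rewrite mxE; exact: H.
apply: fin_bigcap_measurable => [|j _]; first exact: finite_finset.
have mj : measurable_fun setT (fun p : Rn n => k.+1%:R * toV p 0 j).
  by apply: measurable_funM => //; exact: measurable_toV.
rewrite (_ : [set _ | _] =
    (fun p : Rn n => k.+1%:R * toV p 0 j) @^-1` `[(z 0 j)%:~R, (z 0 j + 1)%:~R[).
  by rewrite -[X in measurable X]setTI; apply: mj => //; exact: measurable_itv.
apply/seteqP; split => p /=; rewrite in_itv/=.
  by move=> <-; rewrite real_floor_itv// num_real.
exact: floor_def.
Qed.

(** [G] is the pointwise limit of its values at the grid points of mesh [1 / (k + 1)], and each such
    approximation is constant on countably many measurable cells. *)
Lemma continuous_measurable_toV n (G : 'rV[R]_n -> R) :
  continuous G -> measurable_fun setT (fun p : Rn n => G (toV p)).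
Proof.
move=> cG.
apply: (@measurable_fun_cvg _ _ _ _ (fun k p => (G \o gridV k) (floorV k (toV p)))).
  by move=> k; apply: measurable_countable_fibres => z; exact: measurable_floorV.
move=> p _; exact: (continuous_cvg _ (cG _) (@cvg_gridV _ _)).
Qed.

Lemma floorV_close n k (x y : 'rV[R]_n) : floorV k x = floorV k y ->
  `|x - y| <= k.+1%:R^-1.
Proof.
move=> xy; rewrite /Num.norm/= mx_normrE; apply: bigmax_le => [|/= [i j] _]; first by rewrite invr_ge0.
rewrite (ord1 i) !mxE /=.
have /rowP/(_ j) := xy; rewrite !mxE => xyj.
have k0 : 0 < k.+1%:R :> R by [].
have /andP[] := floor_itv (k.+1%:R * x 0 j); have /andP[] := floor_itv (k.+1%:R * y 0 j).
rewrite xyj intrD => h1 h2 h3 h4.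
have -> : x 0 j - y 0 j = (k.+1%:R * x 0 j - k.+1%:R * y 0 j) / k.+1%:R.
  by field; rewrite gt_eqF.
rewrite normrM (@gtr0_norm _ k.+1%:R^-1) ?invr_gt0// ler_piMl ?invr_ge0//.
by rewrite ler_norml; apply/andP; split; lra.
Qed.

(** An open set is the union of the grid cells, of all mesh sizes, that it contains. *)
Lemma open_measurable_toV n (U : set 'rV[R]_n) :
  open U -> measurable [set p : Rn n | U (toV p)].
Proof.
move=> oU.
rewrite (_ : [set _ | _] = \bigcup_(k : nat) \bigcup_(z in
    [set z | [set p : Rn n | floorV k (toV p) = z] `<=` [set p | U (toV p)]])
    [set p : Rn n | floorV k (toV p) = z]).
  apply: bigcupT_measurable => k; rewrite bigcup_mkcond.
  apply: countable_bigcupT_measurable => // z.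
  by case: ifP => // _; exact: measurable_floorV.
apply/seteqP; split => p /=; last by move=> [k _ [z /= zU pz]]; exact: zU.
move=> Up; have /nbhs_ballP[e /= e0 eU] := oU _ Up.
have [k _ /(_ k) /= /(_ (leqnn _)) ke] := @near_infty_natSinv_lt R (PosNum e0).
exists k => //; exists (floorV k (toV p)) => //= p' pp'; apply: eU.
by rewrite -ball_normE/= (le_lt_trans _ ke)//; apply: floorV_close; rewrite pp'.
Qed.

(** A Cauchy criterion with countable quantifiers only. Applied to difference quotients it exhibits
    the set of non-derivability as a countable combination of measurable sets. *)
Lemma cvg_dnbhs0_rat (q : R -> R) : (forall h, h != 0 -> {for h, continuous q}) ->
  cvg (q h @[h --> 0^']) <->
  forall m : nat, exists k : nat, forall h h' : rat,
    0 < `|ratr h : R| < k.+1%:R^-1 -> 0 < `|ratr h' : R| < k.+1%:R^-1 ->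
    `|q (ratr h) - q (ratr h')| <= m.+1%:R^-1.
Proof.
move=> cq; split.
  move=> /cvg_ex[l ql] m.
  have /cvgrPdist_le/(_ (m.+1%:R^-1 / 2)) := ql.
  rewrite divr_gt0 ?invr_gt0// => /(_ isT)[r /= r0 rq].
  have [k kr] : exists k : nat, k.+1%:R^-1 < r.
    have [k _ /(_ k) /=] := @near_infty_natSinv_lt R (PosNum r0).
    by move=> /(_ (leqnn _)) ?; exists k.
  have H (h : rat) : 0 < `|ratr h : R| < k.+1%:R^-1 -> `|l - q (ratr h)| <= m.+1%:R^-1 / 2.
    move=> /andP[h0 hk]; apply: rq; last by rewrite -normr_gt0.
    by rewrite /= sub0r normrN (lt_trans hk).
  exists k => h h' /H h1 /H h2.
  have -> : q (ratr h) - q (ratr h') = (l - q (ratr h')) - (l - q (ratr h)) by ring.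
  rewrite (le_trans (ler_normB _ _))//; move: h1 h2.
  by set e := m.+1%:R^-1; move: (`|l - _|) (`|l - _|) => x y; lra.
move=> H; apply: cauchy_cvg; apply: cauchy_exP => e e0.
have [m me] : exists m : nat, m.+1%:R^-1 < e / 2.
  have e20 : 0 < e / 2 by rewrite divr_gt0.
  have [m _ /(_ m) /=] := @near_infty_natSinv_lt R (PosNum e20).
  by move=> /(_ (leqnn _)) ?; exists m.
have [k Hk] := H m.
have k0 : 0 < k.+1%:R^-1 :> R by rewrite invr_gt0.
have rat_near (h : R) (d : R) : 0 < d -> exists h' : rat, `|h - ratr h'| < d.
  move=> d0; have [y [/= hd [h' _ h'E]]] := @dense_rat R (ball h d) (ex_intro _ h (ballxx h d0)) (ball_open h d).
  by exists h'; rewrite h'E; move: hd; rewrite -ball_normE.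
have [h0 h0k] := rat_near (k.+1%:R^-1 / 2) (k.+1%:R^-1 / 2) (divr_gt0 k0 (ltr0n _ 2)).
have {h0k}[h00 h0k] : 0 < ratr h0 :> R /\ ratr h0 < k.+1%:R^-1 :> R.
  by move: h0k; rewrite ltr_distlC => /andP[]; set w := _^-1 => ? ?; split; lra.
exists (q (ratr h0)); exists k.+1%:R^-1 => //= h; rewrite /ball_/= sub0r normrN => hk hn0.
rewrite -ball_normE /=.
have := cq h hn0 => /cvgrPdist_lt/(_ (e / 2)); rewrite divr_gt0// => /(_ isT)[d /= d0 qd].
(* A rational within [d1] of [h] is close enough for the continuity of [q] at [h], is nonzero, and
   still lies in the window of radius [1 / (k + 1)]. *)
pose d1 := Num.min d (Num.min `|h| (k.+1%:R^-1 - `|h|)).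
have d10 : 0 < d1 by rewrite !lt_min d0 normr_gt0 hn0 subr_gt0.
have [h' hh'] := rat_near h d1 d10.
move: (hh'); rewrite !lt_min => /and3P[hd h1 h2].
have qq : `|q h - q (ratr h')| < e / 2 by apply: qd.
have q2 : `|q (ratr h0) - q (ratr h')| <= m.+1%:R^-1.
  apply: Hk; apply/andP; split.
  - by rewrite normr_gt0 gt_eqF.
  - by rewrite gtr0_norm.
  - rewrite normr_gt0; apply: contraTneq h1 => ->; by rewrite subr0 ltxx.
  - have -> : ratr h' = h - (h - ratr h') :> R by ring.
    by rewrite (le_lt_trans (ler_normB _ _))//; move: h2; set w := _^-1; lra.
have -> : q (ratr h0) - q h = (q (ratr h0) - q (ratr h')) - (q h - q (ratr h')) by ring.
by rewrite (le_lt_trans (ler_normB _ _))//; move: q2 qq me; set w := m.+1%:R^-1; lra.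
Qed.

(** * Measurability of partial derivatives of continuous functions *)

Section partial_derivative.
Variables (n : nat) (i : 'I_n) (g : 'rV[R]_n -> R).
Hypothesis cg : continuous g.
Let e := @ecoord R n i.
Let q (x : 'rV[R]_n) (h : R) : R := h^-1 *: (g (h *: e + x) - g x).

Let q_cont_h x h : h != 0 -> {for h, continuous (q x)}.
Proof.
move=> h0; apply: cvgZ; first by apply: cvgV => //; exact: cvg_id.
apply: cvgB; last exact: cvg_cst.
apply: continuous_cvg; first exact: cg.
by apply: cvgD; [apply: cvgZr_tmp; exact: cvg_id|exact: cvg_cst].
Qed.

Let q_cont_x h : continuous (q ^~ h).
Proof.
rewrite (_ : q ^~ h = (fun x => h^-1 * (g (h *: e + x) - g x)))// => x.
have FF : Filter (nbhs (x : 'rV[R]_n)) by exact: nbhs_filter.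
apply: cvgM; first exact: cvg_cst.
apply: cvgB; last exact: cg.
apply: continuous_cvg; first exact: cg.
by apply: cvgD; [exact: cvg_cst|exact: cvg_id].
Qed.

Lemma measurable_not_derivable : measurable [set p : Rn n | ~ derivable g (toV p) e].
Proof.
rewrite (_ : [set _ | _] = \bigcup_(m : nat) \bigcap_(k : nat) \bigcup_(h : rat) \bigcup_(h' : rat)
   [set p | [/\ 0 < `|ratr h : R| < k.+1%:R^-1, 0 < `|ratr h' : R| < k.+1%:R^-1 &
     m.+1%:R^-1 < `|q (toV p) (ratr h) - q (toV p) (ratr h')|]]).
  apply: bigcupT_measurable => m; apply: bigcapT_measurable => k.
  apply: bigcupT_measurable_rat => h; apply: bigcupT_measurable_rat => h'.
  have [b1|b1] := boolP (0 < `|ratr h : R| < k.+1%:R^-1); last first.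
    rewrite (_ : [set _ | _] = set0)//; apply/seteqP; split => // p [] //.
  have [b2|b2] := boolP (0 < `|ratr h' : R| < k.+1%:R^-1); last first.
    rewrite (_ : [set _ | _] = set0)//; apply/seteqP; split => // p [] //.
  have mq : measurable_fun setT (fun p : Rn n => `|q (toV p) (ratr h) - q (toV p) (ratr h')|).
    apply: (measurableT_comp (@normr_measurable R setT)).
    apply: measurable_funB.
      exact: (@continuous_measurable_toV _ (q ^~ (ratr h)) (q_cont_x (h := ratr h))).
    exact: (@continuous_measurable_toV _ (q ^~ (ratr h')) (q_cont_x (h := ratr h'))).
  rewrite (_ : [set _ | _] = (fun p : Rn n => `|q (toV p) (ratr h) - q (toV p) (ratr h')|) @^-1` `]m.+1%:R^-1, +oo[).
    by rewrite -[X in measurable X]setTI; apply: mq => //; exact: measurable_itv.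
  by apply/seteqP; split => p /=; rewrite in_itv/= andbT; [case|move=> ?; split].
apply/seteqP; split => p.
  move=> /= nd; apply: contrapT => H; apply: nd.
  apply/(cvg_dnbhs0_rat (q_cont_h (x := toV p))) => m.
  apply: contrapT => nk; apply: H; exists m => // k _.
  apply: contrapT => nh; apply: nk; exists k => h h' hk hk'.
  rewrite leNgt; apply/negP => mq; apply: nh.
  by exists h => //; exists h'.
move=> [m _ H] /= /(cvg_dnbhs0_rat (q_cont_h (x := toV p)))/(_ m)[k Hk].
have [h _ [h' _ [/= h1 h2]]] := H k I.
by rewrite ltNge Hk.
Qed.

Lemma measurable_pd : measurable_fun setT (fun p : Rn n => pd i g (toV p)).
Proof.
pose E := [set p : Rn n | ~ derivable g (toV p) e].
have mE : measurable E := measurable_not_derivable.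
(* Off [E] the difference quotients with step [1 / (k + 1)] converge to [pd]; on [E] the value of
   [pd] is the default [point] of a divergent limit, so the sequence is set to that constant. *)
apply: (@measurable_fun_cvg _ _ _ _ (fun (k : nat) (p : Rn n) =>
   (\1_(~` E) p : R) * q (toV p) k.+1%:R^-1 + (\1_E p : R) * (point : R))).
  move=> k; apply: measurable_funD; apply: measurable_funM => //.
  - by apply: measurable_indic; exact: measurableC.
  - exact: (@continuous_measurable_toV _ (q ^~ k.+1%:R^-1) (q_cont_x (h := k.+1%:R^-1))).
move=> p _; rewrite !indicE /pd /derive.
have [pE|pE] := pselect (derivable g (toV p) e).
  have -> : (p \in E) = false by apply/negP; rewrite inE /E/=.
  have -> : (p \in ~` E) = true by apply/mem_set => /=.
  rewrite mul0r /=.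
  under eq_fun do rewrite mul1r addr0.
  have : q (toV p) h @[h --> 0^'] --> lim (q (toV p) h @[h --> 0^']) by exact: pE.
  move=> /cvgr_dnbhsP; apply; split; last exact: cvg_harmonic.
  by move=> k; rewrite gt_eqF// invr_gt0.
have -> : (p \in E) = true by apply/mem_set.
have -> : (p \in ~` E) = false by apply/negP; rewrite inE /E/=.
under eq_fun do rewrite mul0r add0r mul1r.
rewrite dvgP//; exact: cvg_cst.
Qed.

End partial_derivative.

Definition bndsupp n (G : 'rV[R]_n -> R) :=
  exists M K : R, [/\ 0 < K, forall x, `|G x| <= M &
    forall (x : 'rV[R]_n) j, K < `|x 0 j| -> G x = 0].

Lemma bndsupp_integrable n (G : 'rV[R]_n -> R) :
  measurable_fun setT (fun p : Rn n => G (toV p)) -> bndsupp G ->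
  (mun n).-integrable setT (fun p => (G (toV p))%:E).
Proof.
move=> mG [M [K [K0 GM GK]]].
have [p0 p00] := toV_surj (0 : 'rV[R]_n).
have M0 : 0 <= M by rewrite (le_trans _ (GM 0)).
apply: (@le_integrable _ _ _ _ _ _ _ (fun p => M%:E * (\1_(boxT K p0) p)%:E)%E) => //.
- exact/measurable_EFinP.
- move=> p _; rewrite -EFinM !abse_EFin lee_fin indicE.
  have [pB|pB] := pselect (boxT K p0 p).
    by rewrite mem_set//= mulr1 (ger0_norm M0) GM.
  have -> : G (toV p) = 0.
    apply: contrapT => G0; apply: pB; apply/boxTP => j; rewrite p00 mxE subr0 leNgt.
    by apply/negP => /GK.
  by rewrite normr0.
- apply: integrableZl => //; apply/integrableP; split.
    exact/measurable_EFinP/measurable_indic/measurable_boxT.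
  under eq_integral do rewrite abse_EFin ger0_norm//.
  rewrite integral_indic//; last exact: measurable_boxT.
  by rewrite setIT; suff : (mun n (boxT K p0) < +oo)%E by []; rewrite mun_boxT// ltry.
Qed.

(** Fubini, one coordinate per induction step; bounds and bounded support pass to slices and provide
    integrability at each level. *)
Lemma iintE n (G : 'rV[R]_n -> R) :
  measurable_fun setT (fun p : Rn n => G (toV p)) -> bndsupp G ->
  (iint (fun x => (G x)%:E) = \int[mun n]_p (G (toV p))%:E)%E.
Proof.
elim: n G => [|n IH] G mG bG.
  rewrite /= /mun/= integral_dirac//= ?diracT ?mul1e//.
have := integral12_prod_meas1 (bndsupp_integrable mG bG).
rewrite /mun /= => <-.
apply: eq_integral => x _; rewrite /fubini_F IH//.
  exact: (measurableT_comp mG (pair1_measurable x)).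
have [M [K [K0 GM GK]]] := bG; exists M, K; split => // y j Kj.
apply: (GK _ (lift ord0 j)).
by rewrite mxE; case: splitP => k /=; [rewrite (ord1 k)|rewrite /bump/= add1n => -[jk]; rewrite (_ : k = j)//; apply/val_inj].
Qed.

End iterated_space.

(** * Integration along coordinate lines *)

Section euclidean_norm.
Context {R : realType} {n : nat}.
Implicit Types x y p q : 'rV[R]_n.

Lemma enorm_ge0 x : 0 <= enorm x.
Proof. exact: sqrtr_ge0. Qed.

Lemma sqr_enorm x : enorm x ^+ 2 = \sum_(i < n) x 0 i ^+ 2.
Proof. by rewrite sqr_sqrtr// sumr_ge0// => i _; rewrite sqr_ge0. Qed.

Lemma coord_le_enorm x i : `|x 0 i| <= enorm x.
Proof.
rewrite -sqrtr_sqr ler_wsqrtr// (bigD1 i)//= lerDl sumr_ge0// => j _.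
exact: sqr_ge0.
Qed.

Lemma enorm_le_sum x : enorm x <= \sum_(i < n) `|x 0 i|.
Proof.
have S0 : 0 <= \sum_(i < n) `|x 0 i| by rewrite sumr_ge0.
rewrite -(ger0_norm S0) -sqrtr_sqr ler_wsqrtr//.
rewrite [leRHS]expr2 big_distrl/= ler_sum// => i _.
rewrite -real_normK ?num_real// expr2 ler_wpM2l// (bigD1 i)//= lerDl sumr_ge0//.
Qed.

Lemma coord_le_norm x i : `|x 0 i| <= `|x|.
Proof.
rewrite [leRHS]/Num.norm/= mx_normrE.
exact: (le_bigmax 0 (fun ij : 'I_1 * 'I_n => `|x ij.1 ij.2|) (0, i)).
Qed.

Lemma enorm_le_norm x : enorm x <= n%:R * `|x|.
Proof.
rewrite (le_trans (enorm_le_sum _))//.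
rewrite (le_trans (ler_sum _ (fun i _ => coord_le_norm x i)))//.
by rewrite sumr_const card_ord mulr_natl.
Qed.

Lemma norm_le_coord x r : 0 <= r -> (forall i, `|x 0 i| <= r) -> `|x| <= r.
Proof.
move=> r0 H; rewrite {1}/Num.norm/= mx_normrE; apply: bigmax_le => //.
by move=> /= [i j] _; rewrite (ord1 i).
Qed.

Lemma enorm_ecoord (t : R) (i : 'I_n) : enorm (t *: ecoord R i) = `|t|.
Proof.
rewrite /enorm (bigD1 i)//= big1 => [|j ji].
  by rewrite addr0 !mxE !eqxx mulr1 sqrtr_sqr.
by rewrite !mxE eqxx/= (negbTE ji) mulr0 expr0n.
Qed.

Definition dotV p q := \sum_(i < n) p 0 i * q 0 i.

Lemma dotVV p : dotV p p = enorm p ^+ 2.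
Proof. by rewrite sqr_enorm; apply: eq_bigr => i _; rewrite expr2. Qed.

Lemma dotVB p q q' : dotV p (q - q') = dotV p q - dotV p q'.
Proof. by rewrite /dotV -sumrB; apply: eq_bigr => i _; rewrite !mxE mulrBr. Qed.

(** Cauchy-Schwarz: the squared norm of [enorm p * q - enorm q * p] equals [2 * (enorm p * enorm q)
    * (enorm p * enorm q - dotV p q)] and is nonnegative. *)
Lemma dotV_le p q : dotV p q <= enorm p * enorm q.
Proof.
have [p0|p0] := eqVneq (enorm p) 0.
  have pi0 i : p 0 i = 0.
    by apply/eqP; rewrite -normr_le0 (le_trans (coord_le_enorm _ _))// p0.
  by rewrite /dotV big1 ?mulr_ge0 ?enorm_ge0// => i _; rewrite pi0 mul0r.
have {}p0 : 0 < enorm p by rewrite lt_neqAle eq_sym p0 enorm_ge0.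
have H : 0 <= \sum_(i < n) (enorm p * q 0 i - enorm q * p 0 i) ^+ 2.
  by rewrite sumr_ge0// => i _; exact: sqr_ge0.
have HE : \sum_(i < n) (enorm p * q 0 i - enorm q * p 0 i) ^+ 2 =
    2 * (enorm p * enorm q) * (enorm p * enorm q - dotV p q).
  transitivity (enorm p ^+ 2 * (\sum_(i < n) q 0 i ^+ 2) + enorm q ^+ 2 * (\sum_(i < n) p 0 i ^+ 2)
     - 2 * (enorm p * enorm q) * dotV p q).
    rewrite !mulr_sumr -big_split/= -sumrB; apply: eq_bigr => i _; ring.
  by rewrite -!sqr_enorm; ring.
have [q0|q0] := eqVneq (enorm q) 0.
  have qi0 i : q 0 i = 0.
    by apply/eqP; rewrite -normr_le0 (le_trans (coord_le_enorm _ _))// q0.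
  by rewrite /dotV big1 ?mulr_ge0 ?enorm_ge0// => i _; rewrite qi0 mulr0.
have {}q0 : 0 < enorm q by rewrite lt_neqAle eq_sym q0 enorm_ge0.
by move: H; rewrite HE pmulr_rge0 ?subr_ge0// !mulr_gt0.
Qed.

Lemma nbhsVP x (P : set 'rV[R]_n) :
  nbhs x P <-> exists2 d : R, 0 < d & forall y, `|x - y| < d -> P y.
Proof.
split => [/nbhs_ballP[d d0 dP]|[d d0 dP]].
  by exists d => // y xy; apply: dP; rewrite -ball_normE.
by apply/nbhs_ballP; exists d => //= y; rewrite -ball_normE; exact: dP.
Qed.

Lemma continuousVP (g : 'rV[R]_n -> R) x : {for x, continuous g} <->
  forall e : R, 0 < e -> exists2 d : R, 0 < d & forall y, `|x - y| < d -> `|g x - g y| < e.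
Proof.
have FF : Filter (nbhs x) by exact: nbhs_filter.
split => [gx e e0|gx]; first by apply/nbhsVP; exact: (@cvgr_dist_lt _ _ _ _ _ _ _ gx).
by apply/cvgrPdist_lt => e e0; apply/nbhsVP; exact: gx.
Qed.

Lemma enorm_lipschitz_continuous (g : 'rV[R]_n -> R) L :
  (forall x y, `|g x - g y| <= L * enorm (x - y)) -> continuous g.
Proof.
move=> gL x; apply/continuousVP => e e0.
have L0 : 0 < `|L| * n%:R + 1 by rewrite ltr_wpDl ?mulr_ge0.
exists (e / (`|L| * n%:R + 1)) => /=; first by rewrite divr_gt0.
move=> y; rewrite ltr_pdivlMr// => xy.
rewrite (le_lt_trans (gL _ _))// (le_lt_trans _ xy)//.
rewrite (@le_trans _ _ (`|L| * (n%:R * `|x - y|)))//.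
  rewrite (le_trans (ler_wpM2r (enorm_ge0 _) (ler_norm L)))//.
  by rewrite ler_wpM2l// enorm_le_norm.
by rewrite mulrA mulrC ler_wpM2l// lerDl.
Qed.

End euclidean_norm.

Section lines.
Context {R : realType} {n : nat}.
Implicit Types x y : 'rV[R]_n.

Lemma updD (i : 'I_n) h t x : upd i (h + t) x = h *: ecoord R i + upd i t x.
Proof.
by apply/rowP => j; rewrite !mxE eqxx/=; case: eqVneq => _; rewrite ?mulr1// mulr0 add0r.
Qed.

Lemma upd_id (i : 'I_n) x : upd i (x 0 i) x = x.
Proof. by apply/rowP => j; rewrite mxE; case: eqVneq => [->|]. Qed.

Lemma updB (i : 'I_n) t s x : upd i t x - upd i s x = (t - s) *: ecoord R i.
Proof.
by rewrite -{1}(subrK s t) updD -addrA subrr addr0.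
Qed.

Lemma upd_diff_quotient (i : 'I_n) (g : 'rV[R]_n -> R) t x :
  (fun h : R => h^-1 *: (g (upd i (h *: (1 : R) + t) x) - g (upd i t x))) =
  (fun h : R => h^-1 *: (g (h *: ecoord R i + upd i t x) - g (upd i t x))).
Proof. by apply/funext => h; rewrite -updD [h *: _]mulr1. Qed.

Lemma derivable_upd (i : 'I_n) (g : 'rV[R]_n -> R) t x :
  derivable (fun s : R => g (upd i s x)) t (1 : R) <-> derivable g (upd i t x) (ecoord R i).
Proof. by rewrite /derivable /= upd_diff_quotient. Qed.

Lemma derive_upd (i : 'I_n) (g : 'rV[R]_n -> R) t x :
  'D_(1 : R) (fun s : R => g (upd i s x)) t = 'D_(ecoord R i) g (upd i t x).
Proof. by rewrite /derive /= upd_diff_quotient. Qed.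

Lemma is_derive_upd (i : 'I_n) (g : 'rV[R]_n -> R) t x d :
  is_derive t (1 : R) (fun s : R => g (upd i s x)) d <->
  is_derive (upd i t x) (ecoord R i) g d.
Proof.
split => -[D E]; apply: DeriveDef.
- exact/derivable_upd.
- by rewrite -E derive_upd.
- exact/derivable_upd.
- by rewrite -E derive_upd.
Qed.

Lemma measurable_updT (i : 'I_n) (p : @Rn R n) :
  measurable_fun setT (fun t : measurableTypeR R => updT i t p).
Proof.
elim: n i p => [[]//|m IH] i p.
case: (unliftP ord0 i) => [j|] -> /=.
  apply: (measurable_fun_pair (f := fun=> p.1)) => //; exact: IH.
exact: pair2_measurable.
Qed.

(** Weaker than being Lipschitz, on purpose: it is applied to [F i * z], where [F i] is only known
    to have a bounded derivative in the direction [i]. *)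
Definition line_lipschitz (i : 'I_n) (L : R) (g : 'rV[R]_n -> R) :=
  forall x t s, `|g (upd i t x) - g (upd i s x)| <= L * `|t - s|.

Lemma lipschitz_line (i : 'I_n) L (g : 'rV[R]_n -> R) :
  (forall x y, `|g x - g y| <= L * enorm (x - y)) -> line_lipschitz i L g.
Proof. by move=> gL x t s; rewrite (le_trans (gL _ _))// updB enorm_ecoord. Qed.

Section line_integrals.
Variables (i : 'I_n) (g : 'rV[R]_n -> R) (K L : R).
Hypothesis cg : continuous g.
Hypothesis gL : line_lipschitz i L g.
Hypothesis gK : forall x j, K < `|x 0 j| -> g x = 0.

Let line_density x : exists h : R -> R,
  [/\ (@lebesgue_measure R).-integrable setT (EFin \o h),
      {ae @lebesgue_measure R, forall t : R, is_derive (upd i t x) (ecoord R i) g (h t)} &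
      (\int[@lebesgue_measure R]_t (h t)%:E = 0)%E].
Proof.
(* [lipschitz_density] wants both constants at least [1] and vanishing also at distance exactly [K];
   adding [1] to the absolute values secures both. *)
have K1 : 1 <= `|K| + 1 by rewrite lerDr.
have L1 : 1 <= `|L| + 1 by rewrite lerDr.
have [||h [h1 h2 h3]] := @lipschitz_density _ (fun t => g (upd i t x)) (`|K| + 1) (`|L| + 1) K1 L1.
- move=> t s; rewrite (le_trans (gL _ _ _))// ler_wpM2r//.
  by rewrite (le_trans (ler_norm L))// lerDl.
- move=> t Kt; apply: (gK (j := i)); rewrite updE eqxx (lt_le_trans _ Kt)//.
  by rewrite (le_lt_trans (ler_norm K))// ltrDl.
exists h; split => //.
apply: filterS h2 => [|t ht]; first exact: (ae_filter_ringOfSetsType (@lebesgue_measure R)).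
exact/is_derive_upd.
Qed.

(** Every line in the direction [i] meets this set in a null set, so its indicator has integral [0]
    when the coordinate [i] is integrated first. *)
Lemma null_not_derivable :
  mun n [set p | ~ derivable g (toV p) (ecoord R i)] = 0%E.
Proof.
set E := [set p | _].
have mE : measurable E := measurable_not_derivable i cg.
suff : (\int[mun n]_p (\1_E p)%:E = \int[mun n]_p 0)%E.
  by rewrite integral0 integral_indic// setIT.
apply: (@eq_integral_lines R n i) => //.
- exact/measurable_EFinP/measurable_indic.
- move=> p; rewrite integral0.
  have [h [_ h2 _]] := line_density (toV p).
  transitivity (\int[@lebesgue_measure R]_t (cst 0 t))%E; last by rewrite integral0.
  apply: ae_eq_integral => //.
    apply/measurable_EFinP; apply: measurableT_comp (measurable_updT i p).
    exact: measurable_indic.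
  apply: filterS h2 => [|t ht _]; first exact: (ae_filter_ringOfSetsType (@lebesgue_measure R)).
  rewrite /= indicE (_ : (_ \in E) = false)//.
  apply/negP; rewrite inE /E/= toV_updT; apply.
  by case: ht.
Qed.

(** Integration first in the coordinate [i] is available for nonnegative functions, so positive and
    negative parts are compared: on each line they have equal integrals because the derivative has
    integral [0] there. *)
Lemma integral_pd_eq0 : (mun n).-integrable setT (fun p => (pd i g (toV p))%:E) ->
  (\int[mun n]_p (pd i g (toV p))%:E = 0)%E.
Proof.
move=> ig.
have mpd := measurable_pd i cg.
have mpos : measurable_fun setT (fun p : @Rn R n => (pd i g (toV p))%:E)^\+%E.
  by apply: measurable_funepos; exact/measurable_EFinP.
have mneg : measurable_fun setT (fun p : @Rn R n => (pd i g (toV p))%:E)^\-%E.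
  by apply: measurable_funeneg; exact/measurable_EFinP.
have E : (\int[mun n]_p (fun p => (pd i g (toV p))%:E)^\+ p =
          \int[mun n]_p (fun p => (pd i g (toV p))%:E)^\- p)%E.
  apply: (@eq_integral_lines R n i) => // p.
  have [h [h1 h2 h3]] := line_density (toV p).
  have mh : measurable_fun setT (EFin \o h) by case/integrableP: h1.
  have FF := ae_filter_ringOfSetsType (@lebesgue_measure R).
  transitivity (\int[@lebesgue_measure R]_t ((EFin \o h)^\+ t))%E.
    apply: ae_eq_integral => //.
    - exact: (measurableT_comp mpos (measurable_updT i p)).
    - exact: measurable_funepos.
    - apply: filterS h2 => t ht _; rewrite !funeposE /= toV_updT /pd.
      by case: ht => _ ->.
  transitivity (\int[@lebesgue_measure R]_t ((EFin \o h)^\- t))%E.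
    move: h3; rewrite integralE => /eqP; rewrite sube_eq ?add0e; first by move=> /eqP.
      exact: integrable_pos_fin_num.
    by rewrite fin_num_adde_defl// ; exact: integrable_neg_fin_num.
  apply: ae_eq_integral => //.
  - exact: measurable_funeneg.
  - exact: (measurableT_comp mneg (measurable_updT i p)).
  - apply: filterS h2 => t ht _; rewrite !funenegE /= toV_updT /pd.
    by case: ht => _ ->.
rewrite integralE E subee//; exact: integrable_neg_fin_num.
Qed.

End line_integrals.

(** The second entry of the maximum covers the points of non-derivability, where [pd] takes its
    default value. *)
Lemma pd_bounded (i : 'I_n) L (g : 'rV[R]_n -> R) x : line_lipschitz i L g ->
  `|pd i g x| <= Num.max L `|point : R|.
Proof.
move=> gL; rewrite /pd /derive.
set q := fun h : R => _.
have [cq|nq] := pselect (cvg (q h @[h --> 0^'])); last by rewrite dvgP// le_max lexx orbT.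
rewrite le_max; apply/orP; left.
have : `|q h| @[h --> 0^'] --> `|lim (q h @[h --> 0^'])| by apply: cvg_norm; exact: cq.
move=> /[dup] /cvgP cnq /cvg_lim <-//; apply: limr_le => //.
near=> h; rewrite /q normrM normfV ler_pdivrMl ?normr_gt0; last by near: h; exact: nbhs_dnbhs_neq.
have := gL x (h + x 0 i) (x 0 i); rewrite updD upd_id addrK.
by rewrite mulrC.
Unshelve. all: by end_near. Qed.

Lemma pd_near0 (i : 'I_n) (g : 'rV[R]_n -> R) x :
  (\forall y \near x, g y = 0) -> pd i g x = 0.
Proof.
move=> gx; rewrite /pd -(derive_cst (0 : R) x (ecoord R i)).
by apply: near_eq_derive; apply: filterS gx => y ->.
Qed.

(** At a minimum the difference quotients along [- 1 / (k + 1)] and [1 / (k + 1)] have opposite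
    signs and the same limit. *)
Lemma derive_min_eq0 (v : 'rV[R]_n) (g : 'rV[R]_n -> R) x d :
  (forall y, 0 <= g y) -> g x = 0 -> is_derive x v g d -> d = 0.
Proof.
move=> g0 gx [/[dup] + /cvg_ex[l ql] dE].
have ld : l = d by rewrite -dE; apply/esym/cvg_lim.
rewrite -{}ld {dE d}; move: ql => /cvgr_dnbhsP ql _.
apply/eqP; rewrite eq_le; apply/andP; split.
- have /ql : (forall k : nat, - k.+1%:R^-1 != 0 :> R) /\ - k.+1%:R^-1 @[k --> \oo] --> (0 : R).
    split; first by move=> k; rewrite oppr_eq0 gt_eqF// invr_gt0.
    by rewrite -oppr0; apply: cvgN; exact: cvg_harmonic.
  move=> /[dup] /cvgP c /cvg_lim <-//; apply: limr_le => //.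
  by apply: nearW => k; rewrite /= gx subr0 invrN scaleNr oppr_le0 mulr_ge0// invr_ge0.
- have /ql : (forall k : nat, k.+1%:R^-1 != 0 :> R) /\ k.+1%:R^-1 @[k --> \oo] --> (0 : R).
    split; first by move=> k; rewrite gt_eqF// invr_gt0.
    exact: cvg_harmonic.
  move=> /[dup] /cvgP c /cvg_lim <-//; apply: limr_ge => //.
  by apply: nearW => k; rewrite /= gx subr0 mulr_ge0// invr_ge0.
Qed.

End lines.

(** * Integrals of bounded measurable functions with bounded support *)

Section bndsupp_closure.
Context {R : realType} {n : nat}.
Implicit Types G H : 'rV[R]_n -> R.

Definition testfun G := measurable_fun setT (fun p : @Rn R n => G (toV p)) /\ bndsupp G.

Lemma testfun_integrable G : testfun G ->
  (mun n).-integrable setT (EFin \o (fun p => G (toV p))).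
Proof. by move=> [mG bG]; exact: bndsupp_integrable. Qed.

Lemma testfunD G H : testfun G -> testfun H -> testfun (fun x => G x + H x).
Proof.
move=> [mG [M [K [K0 GM GK]]]] [mH [M' [K' [K'0 HM HK]]]]; split.
  exact: measurable_funD.
exists (M + M'), (K + K'); split; first by rewrite addr_gt0.
  by move=> x; rewrite (le_trans (ler_normD _ _))// lerD.
move=> x j xj; rewrite (GK _ j) ?(HK _ j) ?addr0// (le_lt_trans _ xj)//.
  by rewrite lerDr ltW.
by rewrite lerDl ltW.
Qed.

Lemma testfunZ (c : R) G : testfun G -> testfun (fun x => c * G x).
Proof.
move=> [mG [M [K [K0 GM GK]]]]; split; first exact: measurable_funM.
exists (`|c| * M), K; split => // [x|x j /GK ->]; last by rewrite mulr0.
by rewrite normrM ler_wpM2l.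
Qed.

Lemma testfun_sum (I : Type) (s : seq I) (G : I -> 'rV[R]_n -> R) :
  (forall i, testfun (G i)) -> testfun (fun x => \sum_(i <- s) G i x).
Proof.
move=> tG; elim: s => [|i s IH].
  split; last by exists 0, 1; split => // [x|x j _]; rewrite big_nil ?normr0.
  rewrite (_ : (fun p => _) = cst 0); first exact: measurable_cst.
  by apply/funext => p; rewrite big_nil.
rewrite (_ : (fun x => _) = (fun x => G i x + \sum_(i <- s) G i x)).
  exact: testfunD.
by apply/funext => x; rewrite big_cons.
Qed.

Definition intV G : R := (\int[mun n]_p G (toV p))%R.

Lemma intVD G H : testfun G -> testfun H -> intV (fun x => G x + H x) = intV G + intV H.
Proof. by move=> /testfun_integrable iG /testfun_integrable iH; exact: RintegralD. Qed.

Lemma intVZ c G : testfun G -> intV (fun x => c * G x) = c * intV G.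
Proof. by move=> /testfun_integrable iG; exact: RintegralZl. Qed.

Lemma intV_sum (I : Type) (s : seq I) (G : I -> 'rV[R]_n -> R) :
  (forall i, testfun (G i)) -> (forall i, intV (G i) = 0) ->
  intV (fun x => \sum_(i <- s) G i x) = 0.
Proof.
move=> tG G0; elim: s => [|i s IH].
  by rewrite /intV; under eq_Rintegral do rewrite big_nil; rewrite Rintegral_cst//= ?mul0r.
rewrite (_ : (fun x => _) = (fun x => G i x + \sum_(i <- s) G i x)).
  by rewrite intVD ?G0 ?IH ?addr0//; exact: testfun_sum.
by apply/funext => x; rewrite big_cons.
Qed.

Lemma intV_ae_ge0 G (E : set (@Rn R n)) : testfun G -> measurable E -> mun n E = 0%E ->
  (forall p, ~ E p -> 0 <= G (toV p)) -> 0 <= intV G.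
Proof.
move=> tG mE E0 G0; have [mG bG] := tG.
have mI : measurable_fun setT (\1_(~` E) : @Rn R n -> R).
  by apply: measurable_indic; exact: measurableC.
have -> : intV G = (\int[mun n]_p (\1_(~` E) p * G (toV p)))%R.
  rewrite /intV /Rintegral; congr fine; apply: ae_eq_integral => //.
  - exact/measurable_EFinP.
  - by apply/measurable_EFinP; exact: measurable_funM.
  exists E; split => // p /= H; apply: contrapT => nE; apply: H => _.
  by rewrite indicE mem_set// mul1r.
apply: Rintegral_ge0 => p _; rewrite indicE.
have [pE|pE] := pselect (E p); last by rewrite mem_set// mul1r; exact: G0.
by rewrite memNset ?mul0r//= => /(_ pE).
Qed.

Lemma intV_le G H : testfun G -> testfun H -> (forall x, G x <= H x) -> intV G <= intV H.
Proof. by move=> /testfun_integrable ? /testfun_integrable ? GH; apply: le_Rintegral => // p _. Qed.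

Definition cube (x0 : 'rV[R]_n) (r : R) : set 'rV[R]_n :=
  [set x | forall i, `|x 0 i - x0 0 i| <= r].

Lemma testfun_cube x0 r : testfun (\1_(cube x0 r)).
Proof.
split.
  have [p0 p0E] := toV_surj x0.
  rewrite (_ : (fun p => _) = \1_(boxT r p0)); first exact/measurable_indic/measurable_boxT.
  apply/funext => p; rewrite !indicE; congr (_%:R); congr nat_of_bool.
  by apply/idP/idP; rewrite !inE /cube/= -p0E => /boxTP.
exists 1, (`|x0| + `|r| + 1); split.
- by rewrite ltr_wpDl// addr_ge0.
- by move=> x; rewrite indicE; case: (_ \in _); rewrite ?normr1 ?normr0.
move=> x j xj; rewrite indicE memNset// => /(_ j).
apply/negP; rewrite -ltNge.
have := ler_normD (x 0 j - x0 0 j) (x0 0 j); rewrite subrK.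
have := coord_le_norm x0 j; have := ler_norm r; lra.
Qed.

Lemma intV_cube x0 r : 0 < r -> intV (\1_(cube x0 r)) = (2 * r) ^+ n.
Proof.
move=> r0; have [p0 p0E] := toV_surj x0.
rewrite /intV /Rintegral (_ : (fun p => _) = fun p => (\1_(boxT r p0) p)%:E); last first.
  apply/funext => p; congr EFin; rewrite !indicE; congr (_%:R); congr nat_of_bool.
  by apply/idP/idP; rewrite !inE /cube/= -p0E => /boxTP.
rewrite integral_indic//; last exact: measurable_boxT.
rewrite setIT; have -> // : forall e : \bar R, e = ((2 * r) ^+ n)%:E -> fine e = (2 * r) ^+ n.
  by move=> _ ->.
exact: mun_boxT.
Qed.

Lemma intV_gt0 G x0 : testfun G -> {for x0, continuous G} -> (forall x, 0 <= G x) ->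
  0 < G x0 -> 0 < intV G.
Proof.
move=> tG cG G0 Gx0.
have [|d d0 dG] := (continuousVP G x0).1 cG (G x0 / 2); first by rewrite divr_gt0.
have d20 : 0 < d / 2 by rewrite divr_gt0.
rewrite (@lt_le_trans _ _ (G x0 / 2 * intV (\1_(cube x0 (d / 2)))))//.
  by rewrite intV_cube// mulr_gt0 ?divr_gt0// exprn_gt0// mulr_gt0.
rewrite -intVZ; last exact: testfun_cube.
apply: intV_le => //; first by apply: testfunZ; exact: testfun_cube.
move=> x; rewrite indicE; have [xc|xc] := pselect (cube x0 (d / 2) x).
  rewrite mem_set// mulr1.
  have /dG : `|x0 - x| < d.
    rewrite (@le_lt_trans _ _ (d / 2))//; last by rewrite ltr_pdivrMr// ltr_pMr// ltr1n.
    by apply: norm_le_coord; [exact: ltW|move=> i; rewrite !mxE distrC; exact: xc].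
  by rewrite ltr_distlC => /andP[h1 h2]; lra.
by rewrite memNset// mulr0.
Qed.

End bndsupp_closure.

(** * Calibration *)

Lemma line_mvt (R : realType) (n : nat) (i : 'I_n) (g : 'rV[R]_n -> R) (dg : R -> R)
    (x : 'rV[R]_n) (s t M : R) : s <= t ->
  (forall a, s <= a <= t -> is_derive (upd i a x) (ecoord R i) g (dg a)) ->
  (forall a, s <= a <= t -> `|dg a| <= M) ->
  `|g (upd i t x) - g (upd i s x)| <= M * `|t - s|.
Proof.
move=> st gd dM; have gd' a : s <= a <= t -> is_derive a (1 : R) (fun b : R => g (upd i b x)) (dg a).
  by move=> /gd h; apply/is_derive_upd.
have [||a ast ->] := @MVT_segment _ (fun b : R => g (upd i b x)) dg _ _ st.
- by move=> a; rewrite in_itv/= => /andP[sa at_]; apply: gd'; rewrite !ltW.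
- by apply: derivable_within_continuous => a; rewrite in_itv/= => /gd'[].
by rewrite normrM ler_wpM2r// dM// -in_itv.
Qed.

Lemma null_union d (T : measurableType d) (R : realType) (mu : {measure set T -> \bar R})
    (I : eqType) (s : seq I) (A : I -> set T) :
  (forall i, measurable (A i)) -> (forall i, mu (A i) = 0%E) ->
  exists E, [/\ measurable E, mu E = 0%E & forall i, i \in s -> A i `<=` E].
Proof.
move=> mA A0; elim: s => [|i s [E [mE E0 AE]]]; first by exists set0; rewrite measure0.
exists (A i `|` E); split; first exact: measurableU.
  apply/eqP; rewrite eq_le measure_ge0 andbT (le_trans (measureU2 _ _ _))//.
  by rewrite [X in (X + _)%E]A0 [X in (_ + X)%E]E0 adde0.
move=> j; rewrite inE => /orP[/eqP ->|/AE jE]; first exact: subsetUl.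
by move=> x /jE; right.
Qed.

Section energy.
Context {R : realType} {N : nat}.
Local Notation V := 'rV[R]_N.
Variables (Omega : set V) (f : R -> R) (M0 : R).
Hypothesis oO : open Omega.
Hypothesis bO : forall x, Omega x -> enorm x <= M0.
Hypothesis fnd : nondecreasing_on [set s | 0 <= s] f.
Hypothesis f0 : f 0 = 0.

Definition Jdens (v : V -> R) (x : V) : R := \1_Omega x * (f (enorm (grad v x)) - v x).

Let f_ge0 s : 0 <= s -> 0 <= f s.
Proof. by move=> s0; rewrite -f0; apply: fnd => //=. Qed.

Let lip (L : R) (v : V -> R) := forall x y, `|v x - v y| <= L * enorm (x - y).

Lemma testfun_Jdens L v : lip L v -> testfun (Jdens v).
Proof.
move=> vL; have cv := enorm_lipschitz_continuous vL; split.
  apply: measurable_funM.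
    rewrite (_ : (fun p => _) = \1_[set p : @Rn R N | Omega (toV p)]).
      exact/measurable_indic/open_measurable_toV.
    by apply/funext => p; rewrite !indicE; congr (_%:R); congr nat_of_bool; apply/idP/idP; rewrite !inE.
  apply: measurable_funB; last exact: continuous_measurable_toV.
  (* [f] is monotone on the half-line only; precomposed with [Num.max 0] it is nondecreasing, hence
     measurable, on the whole line. *)
  rewrite (_ : (fun p => _) = (fun s => f (Num.max 0 s)) \o Num.sqrt \o
    (fun p : @Rn R N => \sum_(i < N) pd i v (toV p) ^+ 2)); last first.
    apply/funext => p /=; rewrite max_r ?sqrtr_ge0//; congr (f (Num.sqrt _)).
    by apply: eq_bigr => i _; rewrite mxE.
  apply: measurableT_comp; last first.
    by apply: measurable_sum => i; apply: measurable_funX; exact: measurable_pd.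
  apply: measurableT_comp.
    apply: nondecreasing_measurable => // s t st.
    apply: fnd => /=; [by rewrite le_max lexx|by rewrite le_max lexx|].
    by rewrite ge_max !le_max lexx st orbT.
  by apply: nondecreasing_measurable => // s t st; rewrite ler_wsqrtr.
have [C C0 vC] : exists2 C, 0 <= C & forall i x, `|pd i v x| <= C.
  exists (Num.max L `|point : R|); first by rewrite le_max normr_ge0 orbT.
  by move=> i x; apply: pd_bounded; exact: lipschitz_line.
exists (f (\sum_(i < N) C) + (`|v 0| + `|L * M0|)), (`|M0| + 1); split.
- by rewrite ltr_wpDl.
- move=> x; rewrite /Jdens indicE; have [Ox|Ox] := pselect (Omega x); last first.
    by rewrite memNset// mul0r normr0 !addr_ge0// f_ge0// sumr_ge0.
  rewrite mem_set// mul1r (le_trans (ler_normB _ _))// lerD//.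
    rewrite ger0_norm; last by apply: f_ge0; exact: enorm_ge0.
    apply: fnd => /=; [exact: enorm_ge0|by rewrite sumr_ge0|].
    rewrite (le_trans (enorm_le_sum _))// ler_sum// => i _; rewrite mxE.
    exact: vC.
  have -> : v x = v 0 + (v x - v 0) by ring.
  rewrite (le_trans (ler_normD _ _))// lerD2l (le_trans (vL _ _))// subr0.
  have L0 : 0 <= L * enorm x by have := vL x 0; rewrite subr0; exact: le_trans.
  rewrite -(ger0_norm L0) !normrM ler_wpM2l// ger0_norm ?enorm_ge0//.
  by rewrite (le_trans (bO Ox))// ler_norm.
- move=> x j xj; rewrite /Jdens indicE memNset ?mul0r// => Ox.
  have := coord_le_enorm x j; have := bO Ox; have := ler_norm M0; lra.
Qed.

Lemma Jfun_le u v Lu Lv : lip Lu u -> lip Lv v ->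
  (Jfun f Omega u <= Jfun f Omega v)%E -> intV (Jdens u) <= intV (Jdens v).
Proof.
move=> uL vL.
have [mu_ bu] := testfun_Jdens uL; have [mv bv] := testfun_Jdens vL.
rewrite /Jfun -/(Jdens u) -/(Jdens v) (iintE mu_ bu) (iintE mv bv) => uv.
apply: fine_le => //.
  by apply: integrable_fin_num => //; exact: bndsupp_integrable.
by apply: integrable_fin_num => //; exact: bndsupp_integrable.
Qed.

Section calibration.
Variables (u v : V -> R) (Lu Lv : R) (x0 : V) (r r' : R).
Variables (F dF : 'I_N -> V -> R) (M c delta tau : R).
Let z x := u x - v x.
Hypotheses (uL : lip Lu u) (vL : lip Lv v).
Hypotheses (u0 : forall x, ~ Omega x -> u x = 0) (v0 : forall x, ~ Omega x -> v x = 0).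
Hypothesis Juv : (Jfun f Omega u <= Jfun f Omega v)%E.
Hypotheses (r0 : 0 < r) (rr' : r < r').
Hypothesis cubeO : cube x0 r' `<=` Omega.
Hypothesis z0 : forall x, ~ cube x0 r x -> z x = 0.
Hypothesis FdF : forall x i, cube x0 r' x -> is_derive x (ecoord R i) (F i) (dF i x).
Hypothesis Fc : forall x i, cube x0 r' x -> {for x, continuous (F i)}.
Hypothesis FM : forall x i, cube x0 r' x -> `|F i x| <= M.
Hypothesis dFM : forall x i, cube x0 r' x -> `|dF i x| <= M.
Hypotheses (tau0 : tau != 0) (tauz : forall x, 0 <= tau * z x).
Hypothesis delta0 : 0 <= delta.
Hypothesis calib : forall x, z x != 0 ->
  (forall i, derivable u x (ecoord R i)) -> (forall i, derivable v x (ecoord R i)) ->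
  f (enorm (grad v x)) + \sum_(i < N) F i x * (pd i u x - pd i v x) - delta
    <= f (enorm (grad u x)).
Hypothesis strict : forall x, z x != 0 -> c * `|z x| <= - (\sum_(i < N) dF i x + 1) * z x.

Let zL : lip (Lu + Lv) z.
Proof.
move=> x y; have -> : z x - z y = (u x - u y) - (v x - v y) by rewrite /z; ring.
by rewrite (le_trans (ler_normB _ _))// mulrDl lerD.
Qed.

Let zcube x : z x != 0 -> cube x0 r x.
Proof. by move=> zx; apply: contrapT => /z0 h; move: zx; rewrite h eqxx. Qed.

Let sub_cube : cube x0 r `<=` cube x0 r'.
Proof. by move=> x xr i; rewrite (le_trans (xr i))// ltW. Qed.

(** The gap between [r] and [r'] makes [z] vanish on a neighbourhood of each point outside the
    larger cube, so nothing needs to be known about [F] there. *)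
Let z_near0 x : ~ cube x0 r' x -> \forall y \near x, z y = 0.
Proof.
move=> /existsNP[i /negP]; rewrite -ltNge => xi.
apply/nbhsVP; exists (r' - r); first by rewrite subr_gt0.
move=> y xy; apply: z0 => /(_ i) yi.
have := coord_le_norm (x - y) i; rewrite !mxE => h.
have := ler_normD (x 0 i - y 0 i) (y 0 i - x0 0 i); rewrite addrA subrK => h2.
by lra.
Qed.

Let w i x := F i x * z x.

Let w_near0 i x : ~ cube x0 r' x -> \forall y \near x, w i y = 0.
Proof.
have FF : Filter (nbhs x) by exact: nbhs_filter.
by move=> /z_near0; apply: filterS => y zy; rewrite /w zy mulr0.
Qed.

Let zc : continuous z := enorm_lipschitz_continuous zL.

Let w_continuous i : continuous (w i).
Proof.
move=> x; have FF : Filter (nbhs (x : V)) by exact: nbhs_filter.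
have [xr|xr] := pselect (cube x0 r' x).
  by apply: cvgM; [exact: Fc|exact: zc].
have wx : w i x = 0 by exact: (nbhs_singleton (w_near0 i xr)).
apply/continuousVP => e e0.
have /nbhsVP[d d0 dw] := w_near0 i xr.
by exists d => // y /dw wy; rewrite wx wy subrr normr0.
Qed.

Let zM : exists2 Mz : R, 0 <= Mz & forall x, `|z x| <= Mz.
Proof.
have Mz0 : 0 <= `|z x0| + `|Lu + Lv| * (N%:R * r).
  by rewrite addr_ge0// !mulr_ge0// ltW.
exists (`|z x0| + `|Lu + Lv| * (N%:R * r)) => // x.
have [xr|/z0 ->] := pselect (cube x0 r x); last by rewrite normr0.
have -> : z x = z x0 + (z x - z x0) by ring.
rewrite (le_trans (ler_normD _ _))// lerD2l (le_trans (zL _ _))//.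
rewrite (le_trans (ler_wpM2r (enorm_ge0 _) (ler_norm _)))// ler_wpM2l//.
rewrite (le_trans (enorm_le_norm _))// ler_wpM2l//.
by apply: norm_le_coord; [exact: ltW|move=> i; rewrite !mxE; exact: xr].
Qed.

(** If [z] is nonzero at both ends of a segment, both lie in the cube, hence so does the whole
    segment, and the mean value theorem controls [F i]. If [z] vanishes at one end, a bound on [F i]
    at the other suffices. *)
Let w_line i : exists L, line_lipschitz i L (w i).
Proof.
have [Mz Mz0 zMz] := zM.
have x0r : cube x0 r' x0 by move=> j; rewrite subrr normr0 ltW// (lt_trans r0).
have M_ge0 : 0 <= M by rewrite (le_trans _ (FM i x0r)).
pose Lz := `|Lu + Lv|.
have zl x t s : `|z (upd i t x) - z (upd i s x)| <= Lz * `|t - s|.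
  rewrite (le_trans (lipschitz_line i zL _ _ _))// ler_wpM2r//.
  exact: ler_norm.
have Lz0 : 0 <= Lz by rewrite /Lz.
exists (M * Lz + Mz * M).
have H x t s : s <= t -> `|w i (upd i t x) - w i (upd i s x)| <= (M * Lz + Mz * M) * `|t - s|.
  move=> st.
  have MMz : 0 <= Mz * M * `|t - s| by rewrite !mulr_ge0.
  have [z1|z1] := eqVneq (z (upd i t x)) 0.
    rewrite /w z1 mulr0 sub0r normrN normrM mulrDl.
    have [z2|/zcube/sub_cube z2] := eqVneq (z (upd i s x)) 0.
      by rewrite z2 normr0 mulr0 addr_ge0// !mulr_ge0.
    rewrite ler_wpDr// -mulrA ler_pM//; first exact: FM.
    by have := zl x t s; rewrite z1 sub0r normrN.
  have {}z1 := sub_cube (zcube z1).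
  have [z2|/zcube/sub_cube z2] := eqVneq (z (upd i s x)) 0.
    rewrite /w z2 mulr0 subr0 normrM mulrDl ler_wpDr// -mulrA ler_pM//; first exact: FM.
    by have := zl x t s; rewrite z2 subr0.
  have mid a : s <= a <= t -> cube x0 r' (upd i a x).
    move=> /andP[sa at_] j; have := z1 j; have := z2 j; rewrite !updE.
    by case: eqP => // _; rewrite !ler_distl => /andP[? ?] /andP[? ?]; apply/andP; split; lra.
  have FL : `|F i (upd i t x) - F i (upd i s x)| <= M * `|t - s|.
    apply: (@line_mvt _ _ _ _ (fun a => dF i (upd i a x))) => // a /mid ma.
      exact: FdF.
    exact: dFM.
  have -> : w i (upd i t x) - w i (upd i s x) =
      F i (upd i t x) * (z (upd i t x) - z (upd i s x)) +
      z (upd i s x) * (F i (upd i t x) - F i (upd i s x)) by rewrite /w; ring.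
  rewrite (le_trans (ler_normD _ _))// !normrM mulrDl -!mulrA lerD// ler_pM//; first exact: FM.
move=> x t s; have [st|/ltW ts] := leP s t; first exact: H.
by rewrite distrC (distrC t); exact: H.
Qed.

Let out_cube (x : V) j : `|x0| + r' + 1 < `|x 0 j| -> ~ cube x0 r' x.
Proof.
move=> xj /(_ j) xr; have := ler_normD (x 0 j - x0 0 j) (x0 0 j); rewrite subrK.
by have := coord_le_norm x0 j; lra.
Qed.

Let r'0 : 0 < r'. Proof. exact: lt_trans rr'. Qed.

Let testfun_pdw i : testfun (pd i (w i)).
Proof.
split; first exact: measurable_pd.
have [L wL] := w_line i.
exists (Num.max L `|point : R|), (`|x0| + r' + 1); split.
- by rewrite ltr_wpDl// addr_ge0// ltW.
- by move=> x; exact: pd_bounded.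
- by move=> x j /out_cube /(w_near0 i) h; exact: pd_near0.
Qed.

Let intV_pdw i : intV (pd i (w i)) = 0.
Proof.
have [L wL] := w_line i; rewrite /intV /Rintegral.
rewrite (@integral_pd_eq0 _ _ i (w i) (`|x0| + r' + 1) L)//.
- by move=> x j /out_cube /(w_near0 i) /nbhs_singleton.
- exact: (testfun_integrable (testfun_pdw i)).
Qed.

Let testfun_absz : testfun (fun x => `|z x|).
Proof.
have [Mz Mz0 zMz] := zM; split.
  exact: (measurableT_comp (@normr_measurable R setT) (continuous_measurable_toV zc)).
exists Mz, (`|x0| + r' + 1); split.
- by rewrite ltr_wpDl// addr_ge0// ltW.
- by move=> x; rewrite normr_id.
- by move=> x j /out_cube xr; rewrite z0 ?normr0// => /sub_cube.
Qed.

(** Almost everywhere [Jdens u - Jdens v - div (F z) >= c * |z| - delta] on the larger cube, with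
    equality of the two densities outside it. On integration the divergence disappears, and [Juv]
    makes the difference of energies nonpositive. *)
Lemma calibration_ineq : c * intV (fun x => `|z x|) <= delta * (2 * r') ^+ N.
Proof.
have Ju := testfun_Jdens uL; have Jv := testfun_Jdens vL.
have JJ := Jfun_le uL vL Juv.
have tw : testfun (fun x => \sum_(i <- enum 'I_N) pd i (w i) x) by exact: testfun_sum.
have tc := testfun_cube x0 r'.
have bO' (g : V -> R) : (forall x, ~ Omega x -> g x = 0) -> forall (x : V) j, M0 < `|x 0 j| -> g x = 0.
  by move=> g0 x j xj; apply: g0 => /bO Ox; have := coord_le_enorm x j; lra.
have [Eu [mEu Eu0 EuP]] := @null_union _ _ _ (mun N) _ (enum 'I_N)
  (fun i => [set p | ~ derivable u (toV p) (ecoord R i)])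
  (fun i => measurable_not_derivable i (enorm_lipschitz_continuous uL))
  (fun i => null_not_derivable (enorm_lipschitz_continuous uL) (lipschitz_line i uL) (bO' _ u0)).
have [Ev [mEv Ev0 EvP]] := @null_union _ _ _ (mun N) _ (enum 'I_N)
  (fun i => [set p | ~ derivable v (toV p) (ecoord R i)])
  (fun i => measurable_not_derivable i (enorm_lipschitz_continuous vL))
  (fun i => null_not_derivable (enorm_lipschitz_continuous vL) (lipschitz_line i vL) (bO' _ v0)).
pose B x := Jdens u x + (-1 * Jdens v x + (-1 * (\sum_(i <- enum 'I_N) pd i (w i) x) +
   (- c * `|z x| + delta * \1_(cube x0 r') x))).
have tB4 := testfunD (testfunZ (- c) testfun_absz) (testfunZ delta tc).
have tB3 := testfunD (testfunZ (-1) tw) tB4.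
have tB2 := testfunD (testfunZ (-1) Jv) tB3.
have tB : testfun B := testfunD Ju tB2.
have : 0 <= intV B.
  apply: (intV_ae_ge0 tB (measurableU _ _ mEu mEv)).
    apply/eqP; rewrite eq_le measure_ge0 andbT (le_trans (measureU2 _ _ _))//.
    by rewrite [X in (X + _)%E]Eu0 [X in (_ + X)%E]Ev0 adde0.
  move=> p /not_orP[pu pv].
  set x := toV p.
  have du i : derivable u x (ecoord R i).
    by apply: contrapT => h; apply: pu; apply: (EuP i); rewrite ?mem_enum.
  have dv i : derivable v x (ecoord R i).
    by apply: contrapT => h; apply: pv; apply: (EvP i); rewrite ?mem_enum.
  have same : z x = 0 -> (forall i, pd i u x = pd i v x) -> Jdens u x = Jdens v x.
    move=> zx uv; rewrite /Jdens (_ : grad u x = grad v x); last by apply/rowP => i; rewrite !mxE.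
    by rewrite (_ : u x = v x)//; apply/eqP; rewrite -subr_eq0; apply/eqP.
  rewrite /B; have [xr|xr] := pselect (cube x0 r' x); last first.
    have zx : z x = 0 := nbhs_singleton (z_near0 xr).
    have FF : Filter (nbhs x) by exact: nbhs_filter.
    rewrite same//; last first.
      move=> i; rewrite /pd; apply: near_eq_derive; apply: filterS (z_near0 xr) => y.
      by move=> /eqP; rewrite subr_eq0 => /eqP.
    rewrite big1_seq; last by move=> i _; apply: pd_near0; exact: w_near0.
    by rewrite zx normr0 indicE memNset// !mulr0 !addr0 mulN1r subrr.
  have dz i : is_derive x (ecoord R i) z (pd i u x - pd i v x).
    by apply: is_deriveB; apply: DeriveDef.
  have dw i : pd i (w i) x = F i x * (pd i u x - pd i v x) + z x * dF i x.
    have /(is_deriveM (FdF i xr)) [_] := dz i.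
    by rewrite /pd => ->.
  rewrite (eq_bigr _ (fun i _ => dw i)) indicE mem_set// mulr1.
  (* At a zero of [z] the nonnegative function [tau * z] is minimal, so [u] and [v] have the same
     partial derivatives and the energy densities cancel. *)
  have [zx|zx] := eqVneq (z x) 0.
    have uv i : pd i u x - pd i v x = 0.
      have : is_derive x (ecoord R i) (tau \*: z) (tau *: (pd i u x - pd i v x)).
        exact: is_deriveZ.
      move=> /(derive_min_eq0 tauz); rewrite /= zx mulr0 => /(_ erefl)/eqP.
      by rewrite mulf_eq0 (negbTE tau0) => /eqP.
    rewrite same//; last by move=> i; apply/eqP; rewrite -subr_eq0 uv.
    rewrite big1_seq; last by move=> i _; rewrite uv zx mulr0 mul0r addr0.
    by rewrite zx normr0 !mulr0 !add0r mulN1r addrA subrr add0r.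
  rewrite /Jdens indicE mem_set ?mul1r; last exact: cubeO.
  have h1 := calib zx du dv; have h2 := strict zx.
  rewrite big_split/= -mulr_sumr !big_enum/=.
  move: h1 h2; rewrite /z !mulNr !mul1r.
  move: (f _) (f _) (\sum_(i < N) F i x * _) (\sum_(i < N) dF i x) (c * _) => a1 a2 a3 a4 a5.
  by move: (u x) (v x) => a6 a7; lra.
rewrite [intV B](intVD Ju tB2) (intVD (testfunZ (-1) Jv) tB3) (intVD (testfunZ (-1) tw) tB4).
rewrite (intVD (testfunZ (- c) testfun_absz) (testfunZ delta tc)).
rewrite (intVZ (-1) Jv) (intVZ (-1) tw) (intVZ (- c) testfun_absz) (intVZ delta tc).
by rewrite intV_sum// intV_cube// mulr0 add0r; lra.
Qed.

End calibration.
End energy.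

(** * Touching test functions *)

Section cubes.
Context {R : realType} {n : nat}.
Local Notation V := 'rV[R]_n.
Implicit Types x y : V.

Lemma cubeP x0 (r : R) x : 0 <= r -> cube x0 r x <-> `|x - x0| <= r.
Proof.
move=> r0; split => [xr|xr i].
  by apply: norm_le_coord => // i; rewrite !mxE; exact: xr.
by have := coord_le_norm (x - x0) i; rewrite !mxE => /le_trans; apply.
Qed.

Lemma compact_cube x0 (r : R) : compact (cube x0 r).
Proof.
have := @rV_compact R n (fun i => `[x0 0 i - r, x0 0 i + r]%classic) (fun i => @segment_compact _ _ _).
congr compact; apply/seteqP; split => x /= h i; have := h i; rewrite /= in_itv/= ler_distl//.
Qed.

Lemma bounded_on_cube x0 r (g : V -> R) :
  (forall x, cube x0 r x -> {for x, continuous g}) ->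
  exists2 M : R, 0 <= M & forall x, cube x0 r x -> `|g x| <= M.
Proof.
move=> cg; have [[x xr]|c0] := pselect (cube x0 r !=set0); last first.
  by exists 0 => // x xr; exfalso; apply: c0; exists x.
have cng : {within cube x0 r, continuous (fun y => - `|g y|)}.
  apply: continuous_in_subspaceT => y /set_mem yr.
  have FF : Filter (nbhs (y : V)) by exact: nbhs_filter.
  by apply: cvgN; apply: cvg_norm; exact: cg.
have [y /set_mem yr ymin] := @EVT_min_rV _ _ _ _ (ex_intro _ x xr) (@compact_cube x0 r) cng.
exists `|g y| => // t tr; have := ymin t (mem_set tr); rewrite lerN2//.
Qed.

Lemma cube_nbhs x0 (A : set V) : nbhs x0 A -> exists2 r : R, 0 < r & cube x0 r `<=` A.
Proof.
move=> /nbhsVP[d d0 dA]; exists (d / 2); first by rewrite divr_gt0.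
have d20 : 0 <= d / 2 by rewrite divr_ge0// ltW.
move=> x /(cubeP _ _ d20) xr; apply: dA.
by rewrite distrC (le_lt_trans xr)// ltr_pdivrMr// ltr_pMr// ltr1n.
Qed.

Lemma cubeS x0 (r s : R) : r <= s -> cube x0 r `<=` cube x0 s.
Proof. by move=> rs x xr i; rewrite (le_trans (xr i)). Qed.

Definition hybrid x y (k : nat) : V := \row_j (if (j < k)%N then x 0 j else y 0 j).

(** [hybrid] goes from [y] to [x] changing one coordinate at a time. The intermediate points stay in
    the cube, so the one-variable mean value theorem bounds each of the [n] steps. *)
Lemma cube_lipschitz x0 r (g : V -> R) (M : R) :
  (forall x i, cube x0 r x -> derivable g x (ecoord R i)) ->
  (forall x i, cube x0 r x -> `|pd i g x| <= M) ->
  forall x y, cube x0 r x -> cube x0 r y ->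
  `|g x - g y| <= (n%:R * `|M|) * enorm (x - y).
Proof.
move=> dg gM x y xr yr.
have hN : hybrid x y n = x by apply/rowP => j; rewrite mxE ltn_ord.
have h0 : hybrid x y 0 = y by apply/rowP => j; rewrite mxE.
have hr k : cube x0 r (hybrid x y k) by move=> j; rewrite mxE; case: ifP.
have -> : g x - g y = \sum_(k < n) (g (hybrid x y k.+1) - g (hybrid x y k)).
  rewrite -(big_mkord xpredT (fun k => g (hybrid x y k.+1) - g (hybrid x y k))).
  by rewrite telescope_sumr// hN h0.
rewrite (le_trans (ler_norm_sum _ _ _))//.
have -> : n%:R * `|M| * enorm (x - y) = \sum_(k < n) `|M| * enorm (x - y).
  by rewrite sumr_const card_ord -mulrA mulr_natl.
apply: ler_sum => k _.
have e1 : hybrid x y k.+1 = upd k (x 0 k) (hybrid x y k).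
  apply/rowP => j; rewrite !mxE ltnS; case: (eqVneq j k) => [->|jk]; first by rewrite leqnn.
  by rewrite leq_eqVlt (_ : (j == k :> nat) = false)//; apply/negbTE.
have e2 : hybrid x y k = upd k (y 0 k) (hybrid x y k).
  by apply/rowP => j; rewrite !mxE; case: eqVneq => [->|//]; rewrite ltnn.
rewrite e1 {2}e2.
have H (s t : R) : s <= t -> `|s - x0 0 k| <= r -> `|t - x0 0 k| <= r ->
    `|g (upd k t (hybrid x y k)) - g (upd k s (hybrid x y k))| <= `|M| * `|t - s|.
  move=> st sr tr.
  have mid a : s <= a <= t -> cube x0 r (upd k a (hybrid x y k)).
    move=> /andP[sa at_] j; rewrite updE; case: eqP => [->|_]; last exact: hr.
    by move: sr tr; rewrite !ler_distl => /andP[? ?] /andP[? ?]; apply/andP; split; lra.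
  apply: (@line_mvt _ _ _ _ (fun a => pd k g (upd k a (hybrid x y k)))) => // a /mid ma.
    by apply: DeriveDef => //; exact: dg.
  by rewrite (le_trans (gM _ _ ma))// ler_norm.
have xy : `|x 0 k - y 0 k| <= enorm (x - y).
  by have := coord_le_enorm (x - y) k; rewrite !mxE.
apply: (@le_trans _ _ (`|M| * `|x 0 k - y 0 k|)); last by rewrite ler_wpM2l.
have [yx|/ltW xy'] := leP (y 0 k) (x 0 k); first exact: H.
by rewrite distrC (distrC (x 0 k)); exact: H.
Qed.

(** Projection onto the cube; composing with it extends a Lipschitz function from the cube to the
    whole space with the same constant. *)
Definition clampV x0 (r : R) x : V := \row_i clamp (x0 0 i - r) (x0 0 i + r) (x 0 i).

Lemma clampV_cube x0 r x : 0 <= r -> cube x0 r (clampV x0 r x).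
Proof.
move=> r0 i; rewrite mxE ler_distl clamp_ge clamp_le//; lra.
Qed.

Lemma clampV_id x0 r x : cube x0 r x -> clampV x0 r x = x.
Proof.
move=> xr; apply/rowP => i; rewrite mxE clamp_id//; have := xr i; rewrite ler_distl => /andP[]//.
Qed.

Lemma enorm_clampV x0 r x y : 0 <= r -> enorm (clampV x0 r x - clampV x0 r y) <= enorm (x - y).
Proof.
move=> r0; rewrite ler_wsqrtr// ler_sum// => i _; rewrite !mxE.
rewrite -real_normK ?num_real// -[leRHS]real_normK ?num_real//.
by rewrite lerXn2r ?nnegrE//; apply: clamp_lip; lra.
Qed.

(** Projection onto the larger cube never moves a point into the smaller one, so the extended
    perturbation still vanishes outside the smaller cube. *)
Lemma clampV_far x0 r s x : 0 <= r -> r < s -> ~ cube x0 r x -> ~ cube x0 r (clampV x0 s x).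
Proof.
move=> r0 rs nx xr; apply: nx => i; have := xr i; rewrite mxE.
have ss : x0 0 i - s <= x0 0 i + s by lra.
have [h|h] := leP (x 0 i) (x0 0 i - s).
  by rewrite clamp_below// !ler_distl => /andP[]; lra.
have [h'|h'] := leP (x0 0 i + s) (x 0 i).
  by rewrite clamp_above// !ler_distl => /andP[]; lra.
by rewrite clamp_id// ltW.
Qed.

End cubes.

Section touching.
Context {R : realType} {N : nat}.
Local Notation V := 'rV[R]_N.
Variables (Omega : set V) (f : R -> R) (M0 : R) (u phi : V -> R) (x0 : V) (tau rho c : R).
Hypothesis oO : open Omega.
Hypothesis bO : forall x, Omega x -> enorm x <= M0.
Hypothesis fnd : nondecreasing_on [set s | 0 <= s] f.
Hypothesis f0 : f 0 = 0.
Hypothesis uW : W1inf0 Omega u.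
Hypothesis umin : forall v, W1inf0 Omega v -> (Jfun f Omega u <= Jfun f Omega v)%E.
Hypothesis Ox0 : Omega x0.
Hypothesis phiC2 : C2_on Omega phi.
Hypothesis ux0 : u x0 = phi x0.
Hypothesis tau1 : tau = 1 \/ tau = -1.
Hypothesis touch : forall x, Omega x -> x <> x0 -> tau * (u x - phi x) < 0.
Hypotheses (rho0 : 0 < rho) (c0 : 0 < c).

(* A strict sub- or supersolution of the Euler-Lagrange equation cannot touch
   the minimizer; [F] plays the role of [f'(|Dphi|) Dphi / |Dphi|]. *)
Definition strict_field (C delta : R) (F dF : 'I_N -> V -> R) (M : R) :=
  forall x, cube x0 rho x ->
    [/\ forall i, is_derive x (ecoord R i) (F i) (dF i x) /\ {for x, continuous (F i)},
        forall i, `|F i x| <= M /\ `|dF i x| <= M,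
        c <= - tau * (\sum_(i < N) dF i x + 1) &
        forall q : V, (forall i, `|q 0 i| <= C) ->
          f (enorm (grad phi x)) + \sum_(i < N) F i x * (q 0 i - grad phi x 0 i) - delta
          <= f (enorm q)].

Let ntau : `|tau| = 1.
Proof. by case: tau1 => ->; rewrite ?normrN normr1. Qed.
Let tau_sqr : tau * tau = 1.
Proof. by case: tau1 => ->; rewrite ?mulrNN mulr1. Qed.
Let tau_neq0 : tau != 0.
Proof. by rewrite -normr_gt0 ntau. Qed.

(** The field may change with [delta], but [c], [rho] and the competitor may not; letting [delta]
    tend to [0] contradicts the positivity of the integral of [|z|]. *)
Lemma no_strict_touching :
  (forall C delta, 0 < delta -> exists F dF M, strict_field C delta F dF M) -> False.
Proof.
move=> field.
have [[Lu uL] u0] := uW.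
have cu : continuous u := enorm_lipschitz_continuous uL.
have [phic [phid [_ [phi1c _]]]] := phiC2.
have [rO rO0 rOsub] : exists2 r, 0 < r & cube x0 r `<=` Omega.
  by apply: cube_nbhs; exact: oO.
pose r' := Num.min rho rO.
have r'0 : 0 < r' by rewrite lt_min rho0 rO0.
have r'0' := ltW r'0.
have r'O : cube x0 r' `<=` Omega.
  by apply: subset_trans rOsub; apply: cubeS; rewrite ge_min lexx orbT.
have r'rho : cube x0 r' `<=` cube x0 rho by apply: cubeS; rewrite ge_min lexx.
pose r := r' / 2.
have r_gt0 : 0 < r by rewrite divr_gt0.
have rr' : r < r' by rewrite ltr_pdivrMr// ltr_pMr// ltr1n.
pose g x := tau * (u x - phi x).
have cg x : Omega x -> {for x, continuous g}.
  move=> Ox; have FF : Filter (nbhs (x : V)) by exact: nbhs_filter.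
  by apply: cvgM; [exact: cvg_cst|apply: cvgB; [exact: cu|exact: phic]].
(* Strict touching makes [g] negative on the compact shell between the two cubes, so it has a
   negative maximum there, and [eps] is its opposite. An empty shell allows any [eps]. *)
have [eps eps0 epsP] : exists2 eps : R, 0 < eps &
    forall x, cube x0 r' x -> ~ cube x0 r x -> g x + eps <= 0.
  pose A := cube x0 r' `&` [set x | r <= `|x - x0|].
  have cA : compact A.
    apply: compact_closedI; first exact: compact_cube.
    apply: (@closed_comp _ _ (fun x : V => `|x - x0|) [set t | r <= t]); last exact: closed_ge.
    move=> x _; have FF : Filter (nbhs (x : V)) by exact: nbhs_filter.
    by apply: cvg_norm; apply: cvgB; [exact: cvg_id|exact: cvg_cst].
  have far x : cube x0 r' x -> ~ cube x0 r x -> A x.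
    move=> xr nx; split => //=; rewrite leNgt; apply/negP => /ltW xr'.
    by apply: nx; apply/cubeP => //; exact: ltW.
  have [[y Ay]|nA] := pselect (A !=set0); last first.
    by exists 1 => // x xr nx; exfalso; apply: nA; exists x; exact: far.
  have cng : {within A, continuous (fun y => - g y)}.
    apply: continuous_in_subspaceT => x /set_mem [xr _].
    have FF : Filter (nbhs (x : V)) by exact: nbhs_filter.
    by apply: cvgN; apply: cg; exact: r'O.
  have [m /set_mem [mr mr1] mmin] := EVT_min_rV (ex_intro _ y Ay) cA cng.
  have gm : g m < 0.
    apply: touch; first exact: r'O.
    by move=> mx; move: mr1; rewrite /= mx subrr normr0 leNgt r_gt0.
  exists (- g m); first by rewrite oppr_gt0.
  by move=> x xr nx; have := mmin x (mem_set (far _ xr nx)); rewrite lerN2; lra.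
pose W x := Num.max 0 (g x + eps).
(* [phi] is controlled only inside [Omega]; the projection makes [z] Lipschitz on the whole space,
   as membership of [v] in [W1inf0] demands. *)
pose z x := tau * W (clampV x0 r' x).
have z0 x : ~ cube x0 r x -> z x = 0.
  move=> nx; rewrite /z /W max_l ?mulr0//; apply: epsP; first exact: clampV_cube.
  by apply: clampV_far => //; exact: ltW.
have W0 x : 0 <= W x by rewrite /W le_max lexx.
have tauz x : tau * z x = W (clampV x0 r' x) by rewrite /z mulrA tau_sqr mul1r.
have [M1 M10 phiM] : exists2 M1 : R, 0 <= M1 & forall x i, cube x0 r' x -> `|pd i phi x| <= M1.
  have H i := bounded_on_cube (fun x (xr : cube x0 r' x) => phi1c x i (r'O _ xr)).
  have [B BP] := choice (fun i => let: ex_intro2 M Ma Mb := H i in ex_intro _ M (conj Ma Mb)).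
  exists (\sum_i B i) => [|x i xr]; first by rewrite sumr_ge0// => i _; case: (BP i).
  rewrite (le_trans ((BP i).2 x xr))// (bigD1 i)//= lerDl sumr_ge0// => j _.
  by case: (BP j).
have phiL := cube_lipschitz (fun x i xr => phid x i (r'O _ xr)) phiM.
have zL x y : `|z x - z y| <= (`|Lu| + N%:R * `|M1|) * enorm (x - y).
  rewrite /z -mulrBr normrM ntau mul1r /W.
  have maxl (a b : R) : `|Num.max 0 a - Num.max 0 b| <= `|a - b|.
    have [a0|a0] := leP 0 a; have [b0|b0] := leP 0 b => //.
    - by rewrite subr0 !ger0_norm//; lra.
    - by rewrite sub0r normrN distrC !ger0_norm//; lra.
    - by rewrite subr0 normr0.
  rewrite (le_trans (maxl _ _))//.
  set x' := clampV x0 r' x; set y' := clampV x0 r' y.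
  have -> : g x' + eps - (g y' + eps) = tau * ((u x' - u y') - (phi x' - phi y')).
    by rewrite /g; ring.
  rewrite normrM ntau mul1r (le_trans (ler_normB _ _))// mulrDl lerD//.
    rewrite (le_trans (uL _ _))// (le_trans (ler_wpM2r (enorm_ge0 _) (ler_norm _)))//.
    by rewrite ler_wpM2l// enorm_clampV.
  rewrite (le_trans (phiL _ _ _ _)) ?ler_wpM2l ?enorm_clampV ?mulr_ge0//; exact: clampV_cube.
have zc : continuous z := enorm_lipschitz_continuous zL.
pose v x := u x - z x.
have vL x y : `|v x - v y| <= (Lu + (`|Lu| + N%:R * `|M1|)) * enorm (x - y).
  have -> : v x - v y = (u x - u y) - (z x - z y) by rewrite /v; ring.
  by rewrite (le_trans (ler_normB _ _))// mulrDl lerD.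
have v0 x : ~ Omega x -> v x = 0.
  move=> nO; rewrite /v u0// z0 ?subr0// => xr; apply: nO; apply: r'O.
  by apply: cubeS xr; exact: ltW.
have vW : W1inf0 Omega v by split => //; eexists; exact: vL.
have Juv := umin vW.
have uvz x : u x - v x = z x by rewrite /v; ring.
have zneq x : z x != 0 -> cube x0 r x.
  by move=> zx; apply: contrapT => /z0 h; move: zx; rewrite h eqxx.
have gradv x : z x != 0 -> grad v x = grad phi x.
  move=> zx; have FF : Filter (nbhs (x : V)) by exact: nbhs_filter.
  have xr := zneq _ zx.
  have near_v : \forall y \near x, phi y - tau * eps = v y.
    have [|d d0 dz] := (continuousVP z x).1 (@zc x) `|z x|; first by rewrite normr_gt0.
    apply/nbhsVP; exists d => // y /dz zxy.
    have zy : z y != 0.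
      by apply: contraTneq zxy => ->; rewrite subr0 ltxx.
    have yr' : cube x0 r' y by apply: cubeS (zneq _ zy); exact: ltW.
    rewrite /v /z (clampV_id yr') /W max_r; last first.
      rewrite leNgt; apply/negP => /ltW gy; move: zy.
      by rewrite /z (clampV_id yr') /W max_l// mulr0 eqxx.
    rewrite /g mulrDr mulrA tau_sqr; ring.
  apply/rowP => i; rewrite !mxE /pd -(near_eq_derive _ near_v).
  have dphi : is_derive x (ecoord R i) phi (pd i phi x).
    apply: DeriveDef => //; apply: phid; apply: r'O; apply: cubeS xr; exact: ltW.
  have : is_derive x (ecoord R i) (phi - cst (tau * eps)) (pd i phi x - 0) by exact: is_deriveB.
  by rewrite subr0 => -[_].
have zx0 : z x0 = tau * eps.
  rewrite /z clampV_id; last by move=> i; rewrite subrr normr0.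
  by rewrite /W /g ux0 subrr mulr0 add0r max_r// ltW.
have tf : testfun (fun x => `|z x|).
  split; first exact: (measurableT_comp (@normr_measurable R setT) (continuous_measurable_toV zc)).
  have [M MP zM] := bounded_on_cube (fun x (_ : cube x0 r x) => @zc x).
  exists M, (`|x0| + r + 1); split.
  - by rewrite ltr_wpDl// addr_ge0// ltW.
  - move=> x; rewrite normr_id; have [/zM//|/z0 ->] := pselect (cube x0 r x).
    by rewrite normr0.
  - move=> x j xj; rewrite z0 ?normr0// => /(_ j).
    have := ler_normD (x 0 j - x0 0 j) (x0 0 j); rewrite subrK.
    have := coord_le_norm x0 j; lra.
have Iz : 0 < intV (fun x => `|z x|).
  apply: (@intV_gt0 _ _ _ x0) => //.
    have FF : Filter (nbhs (x0 : V)) by exact: nbhs_filter.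
    by apply: cvg_norm; exact: zc.
  by rewrite zx0 normrM ntau mul1r normr_gt0 gt_eqF.
(* [C] bounds every partial derivative of [u], so the calibration need only be tested on gradients
   of that size. *)
pose C := Num.max Lu `|point : R|.
have key delta : 0 < delta -> c * intV (fun x => `|z x|) <= delta * (2 * r') ^+ N.
  move=> delta0; have [F [dF [M FP]]] := field C delta delta0.
  have FP' x (xr : cube x0 r' x) := FP x (r'rho _ xr).
  have := @calibration_ineq _ _ Omega f M0 oO bO fnd f0 u v Lu _ x0 r r' F dF M c delta tau
    uL vL u0 v0 Juv r_gt0 rr' r'O.
  under [in X in _ -> X]eq_fun do rewrite -uvz.
  apply.
  - by move=> x; rewrite uvz; exact: z0.
  - by move=> x i /FP'[h _ _ _]; case: (h i).
  - by move=> x i /FP'[h _ _ _]; case: (h i).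
  - by move=> x i /FP'[_ h _ _]; case: (h i).
  - by move=> x i /FP'[_ h _ _]; case: (h i).
  - exact: tau_neq0.
  - by move=> x; rewrite uvz tauz.
  - exact: ltW.
  - move=> x; rewrite uvz => zx du dv.
    have [|_ _ _ h] := FP' x; first by apply: cubeS (zneq _ zx); exact: ltW.
    have := h (grad u x).
    rewrite gradv//; under eq_bigr do rewrite 2!mxE.
    have -> : \sum_(i < N) F i x * (pd i u x - pd i phi x) = \sum_(i < N) F i x * (pd i u x - pd i v x).
      by apply: eq_bigr => i _; have /rowP/(_ i) := gradv _ zx; rewrite !mxE => ->.
    by apply => i; rewrite mxE; apply: pd_bounded; exact: lipschitz_line.
  - move=> x; rewrite uvz => zx.
    have [|_ _ h _] := FP' x; first by apply: cubeS (zneq _ zx); exact: ltW.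
    have := ler_wpM2r (W0 (clampV x0 r' x)) h.
    rewrite /z normrM ntau mul1r ger0_norm//; congr (_ <= _); ring.
have : c * intV (fun x => `|z x|) <= 0.
  have P0 : 0 < (2 * r') ^+ N by rewrite exprn_gt0// mulr_gt0.
  rewrite leNgt; apply/negP => cI.
  (* With this [delta] the inequality bounds the positive quantity [c * intV] by half of itself. *)
  have := key (c * intV (fun x => `|z x|) / (2 * ((2 * r') ^+ N))).
  rewrite divr_gt0 ?mulr_gt0// => /(_ isT).
  rewrite invfM mulrA mulrVK ?unitfE ?gt_eqF//; lra.
by rewrite leNgt mulr_gt0.
Qed.

End touching.

(** * Radial fields *)

Section continuityV.
Context {R : realType} {n : nat}.
Local Notation V := 'rV[R]_n.
Implicit Types (x : V) (g h : V -> R).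

Lemma continuousV_cst (a : R) x : {for x, continuous (fun _ : V => a)}.
Proof. have FF : Filter (nbhs (x : V)) by exact: nbhs_filter. exact: cvg_cst. Qed.

Lemma continuousV_add g h x : {for x, continuous g} -> {for x, continuous h} ->
  {for x, continuous (fun y => g y + h y)}.
Proof.
have FF : Filter (nbhs (x : V)) by exact: nbhs_filter.
by move=> *; exact: cvgD.
Qed.

Lemma continuousV_sub g h x : {for x, continuous g} -> {for x, continuous h} ->
  {for x, continuous (fun y => g y - h y)}.
Proof.
have FF : Filter (nbhs (x : V)) by exact: nbhs_filter.
by move=> *; exact: cvgB.
Qed.

Lemma continuousV_mul g h x : {for x, continuous g} -> {for x, continuous h} ->
  {for x, continuous (fun y => g y * h y)}.
Proof.
have FF : Filter (nbhs (x : V)) by exact: nbhs_filter.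
by move=> *; exact: cvgM.
Qed.

Lemma continuousV_inv g x : g x != 0 -> {for x, continuous g} ->
  {for x, continuous (fun y => (g y)^-1)}.
Proof.
have FF : Filter (nbhs (x : V)) by exact: nbhs_filter.
by move=> *; exact: cvgV.
Qed.

Lemma continuousV_comp (k : R -> R) g x : {for x, continuous g} -> {for g x, continuous k} ->
  {for x, continuous (fun y => k (g y))}.
Proof.
have FF : Filter (nbhs (x : V)) by exact: nbhs_filter.
by move=> cg ck; apply: (continuous_cvg _ ck cg).
Qed.

Lemma continuousV_sum (I : Type) (s : seq I) (g : I -> V -> R) x :
  (forall i, {for x, continuous (g i)}) -> {for x, continuous (fun y => \sum_(i <- s) g i y)}.
Proof.
move=> cg; elim: s => [|i s IH].
  rewrite (_ : (fun y => _) = fun=> 0); first exact: continuousV_cst.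
  by apply/funext => y; rewrite big_nil.
rewrite (_ : (fun y => _) = (fun y => g i y + \sum_(i <- s) g i y)).
  exact: continuousV_add.
by apply/funext => y; rewrite big_cons.
Qed.

Lemma continuousV_pos g x : {for x, continuous g} -> 0 < g x ->
  exists2 r : R, 0 < r & forall y, cube x r y -> g x / 2 <= g y.
Proof.
move=> cg gx.
have [|d d0 dg] := (continuousVP g x).1 cg (g x / 2); first by rewrite divr_gt0.
have [r r0 rd] : exists2 r : R, 0 < r & cube x r `<=` [set y | `|x - y| < d].
  by apply: cube_nbhs; apply/nbhsVP; exists d.
by exists r => // y /rd/dg; rewrite ltr_distlC => /andP[]; lra.
Qed.

End continuityV.

Section radial_field.
Context {R : realType} {N : nat}.
Local Notation V := 'rV[R]_N.
Variables (Omega : set V) (phi : V -> R).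
Hypothesis phiC2 : C2_on Omega phi.
Let s x := enorm (grad phi x).
Let Lap x := inf_lap (grad phi x) (hess phi x).
Let T x := \tr (hess phi x).

Lemma enorm_gradE x : s x = Num.sqrt (\sum_(j < N) pd j phi x ^+ 2).
Proof. by rewrite /s /enorm; congr Num.sqrt; apply: eq_bigr => j _; rewrite mxE. Qed.

Lemma continuous_enorm_grad x : Omega x -> {for x, continuous s}.
Proof.
have [_ [_ [_ [pc _]]]] := phiC2 => Ox.
rewrite (_ : s = fun y => Num.sqrt (\sum_(j <- enum 'I_N) pd j phi y * pd j phi y)); last first.
  by apply/funext => y; rewrite enorm_gradE big_enum/=; congr Num.sqrt; apply: eq_bigr => j _; rewrite expr2.
apply: continuousV_comp; last exact: sqrt_continuous.
by apply: continuousV_sum => j; apply: continuousV_mul; exact: pc.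
Qed.

Lemma inf_lapE x : Lap x = \sum_(i < N) \sum_(j < N) pd i (pd j phi) x * pd i phi x * pd j phi x.
Proof. by apply: eq_bigr => i _; apply: eq_bigr => j _; rewrite !mxE. Qed.

Lemma continuous_inf_lap x : Omega x -> {for x, continuous Lap}.
Proof.
have [_ [_ [_ [pc ppc]]]] := phiC2 => Ox.
rewrite (_ : Lap = fun y => \sum_(i <- enum 'I_N) \sum_(j <- enum 'I_N) pd i (pd j phi) y * pd i phi y * pd j phi y); last first.
  by apply/funext => y; rewrite inf_lapE big_enum/=; apply: eq_bigr => j _; rewrite big_enum.
apply: continuousV_sum => i; apply: continuousV_sum => j.
by apply: continuousV_mul; [apply: continuousV_mul; [exact: ppc|exact: pc]|exact: pc].
Qed.

Lemma continuous_lap x : Omega x -> {for x, continuous T}.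
Proof.
have [_ [_ [_ [pc ppc]]]] := phiC2 => Ox.
rewrite (_ : T = fun y => \sum_(i <- enum 'I_N) pd i (pd i phi) y); last first.
  by apply/funext => y; rewrite big_enum/=; apply: eq_bigr => j _; rewrite mxE.
by apply: continuousV_sum => i; exact: ppc.
Qed.

(* Divergence of [k(|Dphi|) Dphi / |Dphi|] where [k' = k1]. *)
Definition radial_div (k k1 : R -> R) (x : V) :=
  (k1 (s x) - k (s x) / s x) / s x ^+ 2 * Lap x + k (s x) / s x * T x.

Lemma continuous_radial_div k k1 x : Omega x -> 0 < s x ->
  {for s x, continuous k} -> {for s x, continuous k1} -> {for x, continuous (radial_div k k1)}.
Proof.
move=> Ox s0 ck ck1.
have cs := continuous_enorm_grad Ox.
have cks := continuousV_comp cs ck; have ck1s := continuousV_comp cs ck1.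
have sn0 : s x != 0 by rewrite gt_eqF.
have cv := continuousV_inv sn0 cs.
rewrite /radial_div; apply: continuousV_add; apply: continuousV_mul.
- apply: continuousV_mul.
    by apply: continuousV_sub => //; exact: continuousV_mul.
  rewrite (_ : (fun y => _) = fun y => (s y)^-1 * (s y)^-1); first exact: continuousV_mul.
  by apply/funext => y; rewrite expr2 invfM.
- exact: continuous_inf_lap.
- exact: continuousV_mul.
- exact: continuous_lap.
Qed.

Let F (k : R -> R) i x := k (s x) / s x * pd i phi x.
(** Chain rule: [(k1 - k / s) / s] is the derivative of [k(t) / t] at [t = s], and the inner sum
    divided by [s] is the partial derivative of [s] in the direction [i]. *)
Let dF (k k1 : R -> R) i x :=
  (k1 (s x) - k (s x) / s x) / s x * ((\sum_(j < N) pd j phi x * pd i (pd j phi) x) / s x) * pd i phi x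
  + k (s x) / s x * pd i (pd i phi) x.

Lemma sum_dF k k1 x : \sum_(i < N) dF k k1 i x = radial_div k k1 x.
Proof.
have TE : T x = \sum_(i < N) pd i (pd i phi) x by apply: eq_bigr => i _; rewrite mxE.
rewrite /radial_div TE inf_lapE !mulr_sumr -big_split/=; apply: eq_bigr => i _; rewrite /dF.
have -> : \sum_(j < N) pd i (pd j phi) x * pd i phi x * pd j phi x =
    pd i phi x * \sum_(j < N) pd j phi x * pd i (pd j phi) x.
  by rewrite mulr_sumr; apply: eq_bigr => j _; rewrite mulrAC mulrC [X in _ * X]mulrC.
move: (\sum_(j < N) pd j phi x * pd i (pd j phi) x) (k1 (s x)) (k (s x)) (pd i phi x) (pd i (pd i phi) x) (s x) => a b c d e t.
by rewrite expr2 invfM; ring.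
Qed.

(** On the line [upd i t x] the partial derivative is an ordinary one, so one-variable rules apply;
    [0 < s x] keeps the square root differentiable. *)
Lemma is_derive_radial k k1 x i : Omega x -> 0 < s x ->
  is_derive (s x) (1 : R) k (k1 (s x)) -> is_derive x (ecoord R i) (F k i) (dF k k1 i x).
Proof.
have [_ [_ [pd2 _]]] := phiC2 => Ox s0 dk.
pose t0 := x 0 i.
pose gam j (t : R) := pd j phi (upd i t x).
have gamE j : gam j t0 = pd j phi x by rewrite /gam upd_id.
have dgam j : is_derive t0 (1 : R) (gam j) (pd i (pd j phi) x).
  by apply/is_derive_upd; rewrite upd_id; apply: DeriveDef => //; exact: pd2.
pose S : R -> R := \sum_(j < N) gam j ^+ 2.
have SE t : S t = \sum_(j < N) pd j phi (upd i t x) ^+ 2.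
  by rewrite /S fct_sumE; apply: eq_bigr => j _; rewrite fctE.
have dS : is_derive t0 (1 : R) S (\sum_(j < N) (2%:R * gam j t0 ^+ 1) *: pd i (pd j phi) x).
  by apply: is_derive_sum => j; exact: is_deriveX.
pose sg := Num.sqrt \o S.
have sgE t : sg t = s (upd i t x) by rewrite /sg /= SE enorm_gradE.
have sg0 : sg t0 = s x by rewrite sgE upd_id.
have S0 : 0 < S t0 by rewrite -sqrtr_gt0 -[Num.sqrt _]/(sg t0) sg0.
have dsg := is_derive1_comp (is_derive1_sqrt S0) dS.
have dk' : is_derive (sg t0) (1 : R) k (k1 (s x)) by rewrite sg0.
have dks := is_derive1_comp dk' dsg.
have sgn0 : sg t0 != 0 by rewrite sg0 gt_eqF.
have dV := is_deriveV sgn0 dsg.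
have := is_deriveM (is_deriveM dks dV) (dgam i).
rewrite (_ : _ * gam i = fun t => F k i (upd i t x)); last first.
  by apply/funext => t; rewrite /F -sgE !fctE.
move=> H; suff : is_derive (upd i t0 x) (ecoord R i) (F k i) (dF k k1 i x) by rewrite upd_id.
apply/is_derive_upd; case: H => H1 H2; apply: DeriveDef => //; rewrite {}H2.
have -> : Num.ExtraDef.sqrtr (S t0) = s x by exact: sg0.
rewrite [X in X *: _ + _](_ : _ = k (s x) / s x); last by rewrite -sg0.
rewrite [(k \o sg) t0](_ : _ = k (s x)); last by rewrite -sg0.
rewrite gamE sg0 /dF.
have -> : \sum_(j < N) (2%:R * gam j t0 ^+ 1) *: pd i (pd j phi) x =
    2 * \sum_(j < N) pd j phi x * pd i (pd j phi) x.
  by rewrite mulr_sumr; apply: eq_bigr => j _; rewrite gamE expr1 /GRing.scale/= mulrA.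
have : s x != 0 by rewrite gt_eqF.
move: (\sum_(j < N) pd j phi x * pd i (pd j phi) x) (k1 (s x)) (k (s x)) (pd i phi x) (pd i (pd i phi) x) (s x) => a b c d e t tn0.
by rewrite /GRing.scale/=; field.
Qed.

Lemma continuous_radial k k1 x i : Omega x -> 0 < s x ->
  is_derive (s x) (1 : R) k (k1 (s x)) -> {for s x, continuous k1} ->
  {for x, continuous (F k i)} /\ {for x, continuous (dF k k1 i)}.
Proof.
have [_ [_ [_ [pc ppc]]]] := phiC2.
move=> Ox s0 dk ck1.
have ck : {for s x, continuous k}.
  by apply: differentiable_continuous; apply/derivable1_diffP; case: dk.
have cs := continuous_enorm_grad Ox.
have cks := continuousV_comp cs ck; have ck1s := continuousV_comp cs ck1.
have sn0 : s x != 0 by rewrite gt_eqF.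
have cv := continuousV_inv sn0 cs.
have ckv := continuousV_mul cks cv.
split; first by apply: continuousV_mul => //; exact: pc.
rewrite /dF; apply: continuousV_add; apply: continuousV_mul => //; last exact: ppc.
  apply: continuousV_mul.
    by apply: continuousV_mul => //; exact: continuousV_sub.
  apply: continuousV_mul => //.
  rewrite (_ : (fun y => _) = fun y => \sum_(j <- enum 'I_N) pd j phi y * pd i (pd j phi) y); last first.
    by apply/funext => y; rewrite big_enum.
  by apply: continuousV_sum => j; apply: continuousV_mul; [exact: pc|exact: ppc].
exact: pc.
Qed.

Lemma radial_field k k1 x0 rho : cube x0 rho `<=` Omega ->
  (forall x, cube x0 rho x -> [/\ 0 < s x, is_derive (s x) (1 : R) k (k1 (s x)) &
      {for s x, continuous k1}]) ->
  exists G M, forall x, cube x0 rho x ->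
   [/\ forall i, is_derive x (ecoord R i) (F k i) (G i x) /\ {for x, continuous (F k i)},
       forall i, `|F k i x| <= M /\ `|G i x| <= M &
       \sum_(i < N) G i x = radial_div k k1 x].
Proof.
move=> sO H.
have B (g : 'I_N -> V -> R) : (forall i x, cube x0 rho x -> {for x, continuous (g i)}) ->
    exists2 M : R, 0 <= M & forall i x, cube x0 rho x -> `|g i x| <= M.
  move=> cg; have h i := bounded_on_cube (cg i).
  have [b bP] := choice (fun i => let: ex_intro2 M Ma Mb := h i in ex_intro _ M (conj Ma Mb)).
  exists (\sum_i b i) => [|i x xr]; first by rewrite sumr_ge0// => i _; case: (bP i).
  rewrite (le_trans ((bP i).2 x xr))// (bigD1 i)//= lerDl sumr_ge0// => j _.
  by case: (bP j).
have cF i x (xr : cube x0 rho x) : {for x, continuous (F k i)} /\ {for x, continuous (dF k k1 i)}.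
  by have [s0 dk ck1] := H x xr; apply: continuous_radial => //; exact: sO.
have [M1 M10 FM] := B _ (fun i x xr => (cF i x xr).1).
have [M2 M20 dFM] := B _ (fun i x xr => (cF i x xr).2).
exists (dF k k1), (M1 + M2) => x xr; have [s0 dk ck1] := H x xr; split.
- by move=> i; split; [apply: is_derive_radial => //; exact: sO|exact: (cF i x xr).1].
- by move=> i; split; [rewrite (le_trans (FM i x xr))// lerDl|rewrite (le_trans (dFM i x xr))// lerDr].
- exact: sum_dF.
Qed.

End radial_field.

(** * Tangent inequalities for convex functions *)

Section convex_tangent.
Context {R : realType}.
Variables (f f1 : R -> R).
Hypothesis fcvx : convex_on [set s | 0 <= s] f.
Hypothesis fnd : nondecreasing_on [set s | 0 <= s] f.

Lemma convex_tangent (s b : R) : 0 < s -> 0 <= b -> is_derive s (1 : R) f (f1 s) ->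
  f s + f1 s * (b - s) <= f b.
Proof.
move=> s0 b0 [/cvg_ex[l fl] dE].
have ld : l = f1 s by rewrite -dE; apply/esym/cvg_lim.
have [bs|bs] := eqVneq b s; first by rewrite bs subrr mulr0 addr0.
have bs0 : b - s != 0 by rewrite subr_eq0.
(* The derivative is computed along [s + t * (b - s)] with [t = 1 / (k + 1)]: convexity compares
   these points with [b] whatever the sign of [b - s]. *)
have U : (forall k : nat, k.+1%:R^-1 * (b - s) != 0) /\
    k.+1%:R^-1 * (b - s) @[k --> \oo] --> (0 : R).
  split; first by move=> k; rewrite mulf_neq0// gt_eqF// invr_gt0.
  by rewrite -(mul0r (b - s)); apply: cvgM; [exact: cvg_harmonic|exact: cvg_cst].
have := (cvgr_dnbhsP _ _ _).1 fl _ U.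
set q := (X in X @ _ --> _) => qlb; rewrite -ld.
have H : q k * (b - s) @[k --> \oo] --> l * (b - s).
  by apply: cvgM; [exact: qlb|exact: cvg_cst].
rewrite addrC -lerBrDr.
move/cvg_lim : (H) => <-//; apply: limr_le; first exact: (cvgP _ H).
apply: nearW => k; rewrite /q /= /GRing.scale/= mulr1.
set t : R := k.+1%:R^-1.
have t0 : 0 < t by rewrite invr_gt0.
have t1 : t <= 1 by rewrite invf_le1// ler1n.
have := fcvx b0 (ltW s0) (ltW t0) t1.
have -> : t * b + (1 - t) * s = t * (b - s) + s by ring.
move: (f _) (f b) (f s) => A B C h.
have -> : (t * (b - s))^-1 * (A - C) * (b - s) = (A - C) / t.
  by field; rewrite bs0 gt_eqF.
by rewrite ler_pdivrMr//; lra.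
Qed.

Lemma derive_ge0_of_nondecreasing (s : R) : 0 < s -> is_derive s (1 : R) f (f1 s) -> 0 <= f1 s.
Proof.
move=> s0 df; have s20 : 0 <= s / 2 by rewrite divr_ge0// ltW.
have := convex_tangent s0 s20 df.
have : f (s / 2) <= f s by apply: fnd => /=; lra.
move=> h1 h2; rewrite leNgt; apply/negP => f10.
have : 0 < f1 s * (s / 2 - s) by rewrite nmulr_rgt0//; lra.
by lra.
Qed.

(** The tangent line of [f] at [enorm p], combined with [enorm q - enorm p >= dotV p (q - p) / enorm
    p] (Cauchy-Schwarz) and [f1 >= 0]. *)
Lemma radial_tangent n (p q : 'rV[R]_n) : 0 < enorm p ->
  is_derive (enorm p) (1 : R) f (f1 (enorm p)) ->
  f (enorm p) + f1 (enorm p) / enorm p * dotV p (q - p) <= f (enorm q).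
Proof.
move=> p0 df; apply: le_trans (convex_tangent p0 (enorm_ge0 q) df).
have f10 := derive_ge0_of_nondecreasing p0 df.
rewrite lerD2l dotVB dotVV -mulrA ler_wpM2l//.
by rewrite mulrC ler_pdivrMr//; have := dotV_le p q; lra.
Qed.

End convex_tangent.

(** * The viscosity inequalities *)

Lemma half_leD (R : realType) (a b : R) : 0 <= a -> - (1 / 2) <= b -> 1 / 2 <= a + b + 1.
Proof. lra. Qed.

Lemma mul_le_half (R : realType) (sigma T : R) : 0 < sigma -> 0 <= T ->
  2 * (sigma / (8 * (T + 1))) * (2 / sigma) * T <= 1 / 2.
Proof.
move=> sigma0 T0; have T1 : 0 < T + 1 by lra.
have -> : 2 * (sigma / (8 * (T + 1))) * (2 / sigma) * T = T / (2 * (T + 1)).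
  by field; rewrite !gt_eqF.
by rewrite ler_pdivrMr; lra.
Qed.

Section viscosity.
Context {R : realType} {N : nat}.
Local Notation V := 'rV[R]_N.
Variables (Omega : set V) (f f1 f2 : R -> R) (M0 sigma : R) (u : V -> R).
Hypothesis oO : open Omega.
Hypothesis bO : forall x, Omega x -> enorm x <= M0.
Hypothesis sigma0 : 0 < sigma.
Hypothesis fcvx : convex_on [set s | 0 <= s] f.
Hypothesis fnd : nondecreasing_on [set s | 0 <= s] f.
Hypothesis f0 : f 0 = 0.
Hypothesis fd : forall s : R, 0 < s -> is_derive s (1 : R) f (f1 s).
Hypothesis f1z : forall s, 0 <= s -> s <= sigma -> f1 s = 0.
Hypothesis f1d : forall s : R, sigma < s -> is_derive s (1 : R) f1 (f2 s).
Hypothesis f2c : forall s : R, sigma < s -> {for s, continuous f2}.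
Hypothesis f2pos : forall s, sigma < s -> 0 < f2 s.
Hypothesis uW : W1inf0 Omega u.
Hypothesis umin : forall v, W1inf0 Omega v -> (Jfun f Omega u <= Jfun f Omega v)%E.

Variables (phi : V -> R) (x0 : V).
Hypothesis Ox0 : Omega x0.
Hypothesis phiC2 : C2_on Omega phi.
Hypothesis ux0 : u x0 = phi x0.

Let s x := enorm (grad phi x).

Let rO : exists2 r : R, 0 < r & cube x0 r `<=` Omega.
Proof. by apply: cube_nbhs; exact: oO. Qed.

Let sc x : Omega x -> {for x, continuous s} := continuous_enorm_grad phiC2 (x := x).

Lemma f_eq0 (t : R) : 0 <= t -> t <= sigma -> f t = 0.
Proof.
rewrite le_eqVlt => /predU1P[<-//|t0 ts].
have := convex_tangent fcvx t0 (lexx 0) (fd t0).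
rewrite f1z ?(ltW t0)// mul0r addr0 f0 => ft.
by apply/eqP; rewrite eq_le ft/= -f0; apply: fnd => //=; exact: ltW.
Qed.

(** Above [sigma] the operator is [- (div F + 1)] times the positive factor [s ^+ 2 / f2 s]. A
    violated inequality thus means [D x0 > 0], and by continuity [D] stays above [D x0 / 2] on a
    small cube. *)
Lemma touching_gt_sigma (tau : R) : tau = 1 \/ tau = -1 ->
  (forall x, Omega x -> x <> x0 -> tau * (u x - phi x) < 0) -> sigma < s x0 ->
  tau * (- (1 - a_fun sigma f1 f2 (s x0)) * inf_lap (grad phi x0) (hess phi x0)
           - s x0 ^+ 2 * a_fun sigma f1 f2 (s x0) * \tr (hess phi x0)
           - b_fun sigma f2 (s x0)) <= 0.
Proof.
move=> tau1 touch sx0; rewrite leNgt; apply/negP => E0.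
have s0 : 0 < s x0 by rewrite (lt_trans sigma0).
have f20 := f2pos sx0.
pose D x := - tau * (radial_div phi f1 f2 x + 1).
have D0 : 0 < D x0.
  move: E0; rewrite /a_fun /b_fun sx0.
  set L := inf_lap _ _; set T := \tr _; set A := f1 (s x0).
  have -> : tau * (- (1 - A / (s x0 * f2 (s x0))) * L - s x0 ^+ 2 * (A / (s x0 * f2 (s x0))) * T
      - s x0 ^+ 2 / f2 (s x0)) = s x0 ^+ 2 / f2 (s x0) * D x0.
    rewrite /D /radial_div -/(s x0) -/L -/T -/A; field.
    by rewrite !gt_eqF.
  by rewrite pmulr_rgt0// divr_gt0// exprn_gt0.
have cD : {for x0, continuous D}.
  apply: continuousV_mul; first exact: continuousV_cst.
  apply: continuousV_add; last exact: continuousV_cst.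
  apply: (continuous_radial_div phiC2) => //; last exact: f2c.
  by apply: differentiable_continuous; apply/derivable1_diffP; case: (f1d sx0).
have [r1 r10 r1D] := continuousV_pos cD D0.
have csig : {for x0, continuous (fun x => s x - sigma)}.
  by apply: continuousV_sub; [exact: sc|exact: continuousV_cst].
have [|r2 r20 r2s] := continuousV_pos csig; first by rewrite subr_gt0.
have [r3 r30 r3O] := rO.
pose rho := Num.min r1 (Num.min r2 r3).
have rho0 : 0 < rho by rewrite !lt_min r10 r20 r30.
have rho1 : cube x0 rho `<=` cube x0 r1 by apply: cubeS; rewrite ge_min lexx.
have rho2 : cube x0 rho `<=` cube x0 r2 by apply: cubeS; rewrite !ge_min lexx orbT.
have rho3 : cube x0 rho `<=` cube x0 r3 by apply: cubeS; rewrite !ge_min lexx !orbT.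
have ssig x : cube x0 rho x -> sigma < s x.
  by move=> /rho2/r2s; move: sx0; lra.
have c0 : 0 < D x0 / 2 by rewrite divr_gt0.
apply: (no_strict_touching oO bO fnd f0 uW umin Ox0 phiC2 ux0 tau1 touch rho0 c0) => C delta delta0.
have [||G [M GM]] := radial_field phiC2 (k := f1) (k1 := f2) (x0 := x0) (rho := rho).
- by move=> x /rho3/r3O.
- move=> x xr; have sx := ssig _ xr; split; [|exact: f1d|exact: f2c].
  by rewrite (lt_trans sigma0).
eexists; exists G, M => x xr; have [G1 G2 G3] := GM x xr; split.
- exact: G1.
- exact: G2.
- by rewrite G3; exact/r1D/rho1.
move=> q _.
have sx := ssig _ xr; have sx_gt0 := lt_trans sigma0 sx.
have := radial_tangent fcvx fnd q sx_gt0 (fd sx_gt0).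
apply: le_trans; rewrite -addrA lerD2l.
rewrite /dotV mulr_sumr lerBlDr ler_wpDr ?(ltW delta0)//.
by rewrite le_eqVlt; apply/orP; left; apply/eqP; apply: eq_bigr => i _; rewrite !mxE mulrA.
Qed.

(** With the zero field the divergence condition holds with [c = 1], and the calibration reduces to
    [0 <= f], because [f] vanishes on [[0, sigma]]. *)
Lemma touching_lt_sigma :
  (forall x, Omega x -> x <> x0 -> phi x < u x) -> sigma <= s x0.
Proof.
move=> touch; rewrite leNgt; apply/negP => sx0.
have csig : {for x0, continuous (fun x => sigma - s x)}.
  by apply: continuousV_sub; [exact: continuousV_cst|exact: sc].
have [|r2 r20 r2s] := continuousV_pos csig; first by rewrite subr_gt0.
have touch' x : Omega x -> x <> x0 -> -1 * (u x - phi x) < 0.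
  by move=> Ox xx0; have := touch x Ox xx0; lra.
apply: (no_strict_touching oO bO fnd f0 uW umin Ox0 phiC2 ux0 (or_intror erefl) touch' r20 ltr01).
move=> C delta delta0; exists (fun _ _ => 0), (fun _ _ => 0), 0 => x xr; split.
- move=> i; split; last exact: continuousV_cst.
  exact: (is_derive_cst (0 : R) x (ecoord R i)).
- by move=> i; rewrite normr0.
- by rewrite big1// add0r opprK mulr1.
move=> q _; rewrite big1 ?addr0; last by move=> i _; rewrite mul0r.
rewrite f_eq0; [|exact: enorm_ge0|by have := r2s _ xr; rewrite -/(s x); move: sx0; lra].
rewrite sub0r; apply: (@le_trans _ _ 0); first by rewrite oppr_le0 ltW.
by rewrite -f0; apply: fnd => //=; exact: enorm_ge0.
Qed.

(** * Contact points with gradient norm equal to [sigma] *)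

Section at_sigma.
Variables (fn1 fn2 : nat -> R -> R).
Hypothesis f1c : {for sigma, continuous f1}.
Hypothesis f2inf : f2 t @[t --> sigma^'+] --> +oo.
Hypothesis fn1d : forall n (t : R), 0 < t -> is_derive t (1 : R) (fn1 n) (fn2 n t).
Hypothesis fn2c : forall n (t : R), 0 < t -> {for t, continuous (fn2 n)}.
Hypothesis fn2pos : forall n t, 0 < t -> 0 < fn2 n t.
Hypothesis fn1cv : unif_cvg_compact fn1 f1 [set t | 0 <= t].
Hypothesis acv : unif_cvg_compact (fun n => an_fun (fn1 n) (fn2 n)) (a_fun sigma f1 f2)
    [set t | 0 < t].

(* Near [sigma] the coefficient [a] is small, so [a_n <= 1] there. *)
Lemma near_sigma (e : R) : 0 < e -> exists2 eta : R, 0 < eta &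
  forall t, sigma / 2 <= t -> t <= sigma + eta ->
    [/\ 0 <= f1 t, f1 t <= e & a_fun sigma f1 f2 t <= 1 / 2].
Proof.
move=> e0.
(* Capping at [1] gives [f1 t <= 1]; together with [t * f2 t >= 2] this yields [a <= 1 / 2], leaving
   room for an error [1 / 2] in [a_n <= 1]. *)
pose e' := Num.min e 1.
have e'0 : 0 < e' by rewrite lt_min e0 ltr01.
have /cvgrPdist_lt/(_ _ e'0)[d /= d0 df1] := f1c.
have /cvgryPge/(_ (2 / sigma))[d' /= d'0 df2] := f2inf.
exists (Num.min (d / 2) (d' / 2)); first by rewrite lt_min !divr_gt0.
move=> t st; rewrite -lerBlDl le_min => /andP[td td'].
have t0 : 0 < t by rewrite (lt_le_trans _ st)// divr_gt0.
have f1t0 := derive_ge0_of_nondecreasing fcvx fnd t0 (fd t0).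
have [ts|st'] := leP t sigma.
  by rewrite /a_fun ltNge ts/= f1z ?(ltW t0)//; split; rewrite ?(ltW e0)//; lra.
have f1e' : f1 t < e'.
  have /df1 : `|sigma - t| < d by rewrite ltr0_norm; lra.
  by rewrite f1z ?(ltW sigma0)// sub0r normrN ger0_norm.
move: f1e'; rewrite lt_min => /andP[f1e f11].
have f2t : 2 / sigma <= f2 t.
  by apply: df2 => //=; rewrite ltr0_norm; lra.
split => //; first exact: ltW.
rewrite /a_fun st' ler_pdivrMr ?mulr_gt0 ?f2pos//.
apply: (@le_trans _ _ 1); first exact: ltW.
rewrite div1r ler_pdivlMl// mulr1.
have -> : 2 = sigma * (2 / sigma) by field; rewrite gt_eqF.
by apply: ler_pM => //; [exact: ltW|rewrite divr_ge0// ltW|exact: ltW].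
Qed.

(** The cube is fixed by [phi] and [eta], before [C] and [delta]; only the index [n] is chosen
    afterwards. On the cube [|Dphi|] may lie on either side of [sigma], hence the two-sided range in
    [near_sigma]. *)
Lemma touching_eq_sigma :
  (forall x, Omega x -> x <> x0 -> phi x < u x) -> s x0 = sigma ->
  inf_lap (grad phi x0) (hess phi x0) <= 0.
Proof.
move=> touch sx0; rewrite leNgt; apply/negP => L0.
have touch' x : Omega x -> x <> x0 -> -1 * (u x - phi x) < 0.
  by move=> Ox xx0; have := touch x Ox xx0; lra.
have [r3 r30 r3O] := rO.
have [Tb Tb0 TbP] := bounded_on_cube (fun x (xr : cube x0 r3 x) => continuous_lap phiC2 (r3O _ xr)).
(* If [f1 <= e] and [fn1] is within [e] of it, then with [s >= sigma / 2] the trace term of the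
   divergence is at most [2 * e * (2 / sigma) * Tb <= 1 / 2]. The [+ 1] guards against [Tb = 0]. *)
pose e := sigma / (8 * (Tb + 1)).
have Tb1 : 0 < 8 * (Tb + 1) by lra.
have e0 : 0 < e by rewrite divr_gt0.
have [eta eta0 etaP] := near_sigma e0.
have [r1 r10 r1L] := continuousV_pos (continuous_inf_lap phiC2 Ox0) L0.
have [|r2 r20 r2s] := continuousV_pos (sc Ox0); first by rewrite sx0.
have csig : {for x0, continuous (fun x => sigma + eta - s x)}.
  by apply: continuousV_sub; [exact: continuousV_cst|exact: sc].
have [|r4 r40 r4s] := continuousV_pos csig; first by rewrite sx0; lra.
pose rho := Num.min (Num.min r1 r2) (Num.min r3 r4).
have rho0 : 0 < rho by rewrite !lt_min r10 r20 r30 r40.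
have rho1 : cube x0 rho `<=` cube x0 r1 by apply: cubeS; rewrite !ge_min lexx.
have rho2 : cube x0 rho `<=` cube x0 r2 by apply: cubeS; rewrite !ge_min lexx ?orbT.
have rho3 : cube x0 rho `<=` cube x0 r3 by apply: cubeS; rewrite !ge_min lexx ?orbT.
have rho4 : cube x0 rho `<=` cube x0 r4 by apply: cubeS; rewrite !ge_min lexx ?orbT.
have sK x : cube x0 rho x -> sigma / 2 <= s x <= sigma + eta.
  move=> xr; apply/andP; split; first by have := r2s _ (rho2 _ xr); rewrite sx0.
  by have := r4s _ (rho4 _ xr); rewrite sx0; lra.
have half0 : 0 < 1 / 2 :> R by lra.
apply: (no_strict_touching oO bO fnd f0 uW umin Ox0 phiC2 ux0 (or_intror erefl) touch' rho0 half0).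
move=> C delta delta0.
(* [B] bounds [enorm (q - Dphi)] for every admissible [q], the final [1] making it positive;
   [delta / B] is then the accuracy needed of [fn1]. *)
pose B : R := N%:R * (`|C| + (sigma + eta)) + 1.
have B0 : 0 < B.
  apply: ltr_wpDl => //; apply: mulr_ge0 => //; apply: addr_ge0 => //.
  by apply: addr_ge0; exact: ltW.
pose e2 := Num.min e (delta / B).
have e20 : 0 < e2 by rewrite lt_min e0 divr_gt0.
have s20 : 0 < sigma / 2 by rewrite divr_gt0.
pose K := `[sigma / 2, sigma + eta]%classic.
have cK : compact K by exact: segment_compact.
have Kgt0 : K `<=` [set t | 0 < t].
  by move=> t; rewrite /K /= in_itv/= => /andP[h _]; exact: lt_le_trans h.
have Kge0 : K `<=` [set t | 0 <= t] by move=> t /Kgt0; exact: ltW.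
have [n1 _ n1P] := fn1cv cK Kge0 e20.
have [n2 _ n2P] := acv cK Kgt0 half0.
pose n := maxn n1 n2.
have fnP t : sigma / 2 <= t <= sigma + eta -> `|fn1 n t - f1 t| < e2.
  by move=> tK; apply: n1P => //; exact: leq_maxl.
have anP t : sigma / 2 <= t <= sigma + eta -> `|an_fun (fn1 n) (fn2 n) t - a_fun sigma f1 f2 t| < 1 / 2.
  by move=> tK; apply: n2P => //; exact: leq_maxr.
have [||G [M GM]] := radial_field phiC2 (k := fn1 n) (k1 := fn2 n) (x0 := x0) (rho := rho).
- by move=> x /rho3/r3O.
- move=> x xr; have /andP[sx _] := sK _ xr.
  have sx_gt0 : 0 < s x by rewrite (lt_le_trans s20).
  by split; [|exact: fn1d|exact: fn2c].
eexists; exists G, M => x xr; have [G1 G2 G3] := GM x xr.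
have sKx := sK _ xr; have /andP[sx1 sx2] := sKx.
have sx_gt0 : 0 < s x by rewrite (lt_le_trans s20).
have [f1x0 f1xe ax] := etaP _ sx1 sx2.
have fnx := fnP _ sKx; have anx := anP _ sKx.
split.
- exact: G1.
- exact: G2.
- rewrite G3 opprK [leRHS]mul1r.
  (* [a_n <= 1] says exactly that the coefficient of the infinity-Laplacian in the divergence is
     nonnegative. *)
  have k1 : fn1 n (s x) / s x <= fn2 n (s x).
    have : an_fun (fn1 n) (fn2 n) (s x) <= 1.
      by move: anx; rewrite ltr_distlC => /andP[]; lra.
    rewrite /an_fun ler_pdivrMr ?mulr_gt0 ?fn2pos// mul1r.
    by rewrite ler_pdivrMr// mulrC.
  have t1 : 0 <= (fn2 n (s x) - fn1 n (s x) / s x) / s x ^+ 2 * inf_lap (grad phi x) (hess phi x).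
    apply: mulr_ge0.
      by apply: divr_ge0; [rewrite subr_ge0|apply: exprn_ge0; exact: ltW].
    by apply: ltW; rewrite (lt_le_trans _ (r1L _ (rho1 _ xr)))// divr_gt0.
  have t2 : `|fn1 n (s x) / s x * \tr (hess phi x)| <= 1 / 2.
    rewrite normrM normrM (@gtr0_norm _ (s x)^-1) ?invr_gt0//.
    have h1 : `|fn1 n (s x)| <= 2 * e.
      have := ler_normD (fn1 n (s x) - f1 (s x)) (f1 (s x)); rewrite subrK (ger0_norm f1x0).
      move=> /le_trans; apply; rewrite mulr_natl mulr2n lerD//.
      by move: fnx; rewrite lt_min => /andP[/ltW].
    have h2 : (s x)^-1 <= 2 / sigma by rewrite -[leRHS]invrK invf_div lef_pV2 ?posrE.
    have h3 := TbP _ (rho3 _ xr).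
    apply: (@le_trans _ _ (2 * e * (2 / sigma) * Tb)).
      by apply: ler_pM => //; [rewrite mulr_ge0// invr_ge0 ltW|apply: ler_pM => //; rewrite invr_ge0 ltW].
    exact: mul_le_half.
  by move: t2; rewrite ler_norml => /andP[t2 _]; exact: half_leD.
move=> q qC.
(* The tangent inequality holds with [f1], while the field uses [fn1]. The exchange costs at most
   [|fn1 - f1| * enorm (q - p)], which is below [delta / B * B]. *)
have := radial_tangent fcvx fnd q sx_gt0 (fd sx_gt0).
apply: le_trans; rewrite -/(s x) -addrA lerD2l.
set p := grad phi x.
have -> : \sum_(i < N) fn1 n (s x) / s x * pd i phi x * (q 0 i - p 0 i) =
    fn1 n (s x) / s x * dotV p (q - p).
  by rewrite /dotV mulr_sumr; apply: eq_bigr => i _; rewrite !mxE mulrA.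
have dab : `|dotV p (q - p)| <= s x * enorm (q - p).
  rewrite ler_norml dotV_le andbT lerNl.
  have -> : - dotV p (q - p) = dotV p (p - q) by rewrite !dotVB opprB.
  rewrite (le_trans (dotV_le _ _))// ler_wpM2l ?enorm_ge0//.
  by rewrite le_eqVlt; apply/orP; left; apply/eqP; congr Num.sqrt; apply: eq_bigr => i _; rewrite !mxE -sqrrN opprB.
have eB : enorm (q - p) <= B.
  rewrite (le_trans (enorm_le_sum _))// ler_wpDr//.
  have -> : N%:R * (`|C| + (sigma + eta)) = \sum_(i < N) (`|C| + (sigma + eta)).
    by rewrite sumr_const card_ord mulr_natl.
  apply: ler_sum => i _; rewrite 2!mxE (le_trans (ler_normB _ _))// lerD//.
    by rewrite (le_trans (qC i))// ler_norm.
  by rewrite (le_trans (coord_le_enorm _ _)).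
have : (fn1 n (s x) - f1 (s x)) / s x * dotV p (q - p) <= delta.
  rewrite (le_trans (ler_norm _))// normrM normrM (@gtr0_norm _ (s x)^-1) ?invr_gt0//.
  apply: (@le_trans _ _ (delta / B / s x * (s x * B))).
    apply: ler_pM => //; first by rewrite mulr_ge0// invr_ge0 ltW.
      apply: ler_wpM2r; first by rewrite invr_ge0 ltW.
      by apply: ltW; rewrite (lt_le_trans fnx)// ge_min lexx orbT.
    by rewrite (le_trans dab)// ler_wpM2l// ltW.
  by rewrite le_eqVlt; apply/orP; left; apply/eqP; field; rewrite !gt_eqF.
by rewrite !mulrBl; lra.
Qed.

End at_sigma.
End viscosity.

Lemma continuous_within_halfline (R : realType) (g : R -> R) (t : R) :
  {within [set s | 0 <= s], continuous g} -> 0 < t -> {for t, continuous g}.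
Proof.
move=> cg t0.
have cg' : {within `[0, +oo[, continuous g}.
  by rewrite (_ : [set` _] = [set s | 0 <= s])//; apply/seteqP; split => s /=; rewrite in_itv/= andbT.
have [/(_ t) + _] := (continuous_within_itvcyP _ _).1 cg'.
by apply; rewrite in_itv/= t0.
Qed.

Theorem theorem3p3 (R : realType) (N : nat) (Omega : set 'rV[R]_N) (alpha : R)
  (f f1 f2 f3 : R -> R) (sigma : R)
  (fn fn1 fn2 fn3 : nat -> R -> R) (u : 'rV[R]_N -> R) :
  (2 <= N)%N ->
  (* Omega: bounded domain with C^{2,alpha} boundary *)
  bounded_domain Omega -> 0 < alpha -> alpha <= 1 ->
  C2alpha_boundary alpha Omega ->
  (* standing assumptions (A) on f, with f1 = f', f2 = f'', f3 = f''' *)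
  0 < sigma ->
  convex_on [set s | 0 <= s] f ->
  nondecreasing_on [set s | 0 <= s] f ->
  C1_closed_halfline f f1 ->
  C3_tail_on [set s | sigma < s] f1 f2 f3 ->
  f 0 = 0 ->
  f s / s @[s --> +oo] --> +oo ->
  (forall s, 0 <= s -> s <= sigma -> f1 s = 0) ->
  (forall s, sigma < s -> 0 < f2 s) ->
  (* additional assumption *)
  f2 s @[s --> sigma^'+] --> +oo ->
  (* the approximating sequence f_n, with fn1 n = f_n', fn2 n = f_n'', fn3 n = f_n''' *)
  (forall n, convex_on [set s | 0 <= s] (fn n)) ->
  (forall n, fn n 0 = 0) ->
  (forall n, fn n s / s @[s --> +oo] --> +oo) ->
  (* (i) *)
  (forall n, C1_closed_halfline (fn n) (fn1 n)) ->
  (forall n, C3_tail_on [set s | 0 < s] (fn1 n) (fn2 n) (fn3 n)) ->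
  (* (ii) *)
  unif_cvg_compact fn f [set s | 0 <= s] ->
  (* (iii) *)
  (forall n, fn1 n 0 = 0) ->
  (forall n s, 0 <= s -> fn1 n.+1 s <= fn1 n s) ->
  unif_cvg_compact fn1 f1 [set s | 0 <= s] ->
  (* (iv) *)
  (forall n s, 0 < s -> 0 < fn2 n s) ->
  (* (v) *)
  (forall n, (s * fn2 n s - fn1 n s) / s ^+ 3 @[s --> 0^'+] --> 0) ->
  (forall n, fn1 n s / s @[s --> 0^'+] --> 0) ->
  (* (vi) *)
  unif_cvg_compact (fun n => ext0 (fun s => (s * fn2 n s - fn1 n s) / s ^+ 3))
    (fun _ => 0) [set s | 0 <= s < sigma] ->
  unif_cvg_compact (fun n => ext0 (fun s => fn1 n s / s))
    (fun _ => 0) [set s | 0 <= s < sigma] ->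
  (* (vii) *)
  unif_cvg_compact (fun n => an_fun (fn1 n) (fn2 n)) (a_fun sigma f1 f2)
    [set s | 0 < s] ->
  unif_cvg_compact (fun n => bn_fun (fn2 n)) (b_fun sigma f2)
    [set s | sigma < s] ->
  (* u is the minimizer of J over W^{1,oo}_0(Omega) *)
  W1inf0 Omega u ->
  (forall v, W1inf0 Omega v -> (Jfun f Omega u <= Jfun f Omega v)%E) ->
  visc_solution Omega (Gop sigma f1 f2) u.
Proof.
move=> _ [oO [_ [_ [M0 bO]]]] _ _ _ sigma0 fcvx fnd [fd [_ f1cw]] [f1d [f2d _]] f0 _ f1z.
move=> f2pos f2inf _ _ _ _ fnC3 _ _ _ fn1cv fn2pos _ _ _ _ acv _ uW umin.
have dc (g dg : R -> R) (t : R) : is_derive t (1 : R) g (dg t) -> {for t, continuous g}.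
  by move=> [h _]; apply: differentiable_continuous; apply/derivable1_diffP.
have f2c t : sigma < t -> {for t, continuous f2} by move=> /f2d; exact: dc.
have gt_case := touching_gt_sigma oO bO sigma0 fcvx fnd f0 fd f1d f2c f2pos uW umin.
split; first by case: uW => -[L uL] _ x _; exact: (enorm_lipschitz_continuous uL).
split=> x0 phi Ox0 phiC2 ux0 touch; rewrite /Gop.
  (* A minimum is nonpositive once one entry is, so the subsolution inequality has content only
     above [sigma]. *)
  rewrite ge_min; have [ss|ss] := leP (enorm (grad phi x0)) sigma.
    by apply/orP; right; rewrite subr_le0.
  apply/orP; left.
  have := gt_case phi x0 Ox0 phiC2 ux0 1 (or_introl erefl) _ ss; rewrite mul1r; apply.
  by move=> x Ox xx0; have := touch x Ox xx0; lra.
have le_case := touching_lt_sigma oO bO fcvx fnd f0 fd f1z uW umin Ox0 phiC2 ux0 touch.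
rewrite le_min; apply/andP; split; last by rewrite subr_ge0.
move: le_case; rewrite le_eqVlt => /predU1P[ss|ss].
  (* At [sigma] itself both coefficients are [0] by definition, so the first entry is minus the
     infinity-Laplacian. *)
  rewrite /a_fun /b_fun -ss ltxx subr0 mulr0 mul0r !subr0 mulN1r oppr_ge0.
  apply: (touching_eq_sigma oO bO sigma0 fcvx fnd f0 fd f1z f2pos uW umin Ox0 phiC2 ux0
    (fn1 := fn1) (fn2 := fn2)) => //.
  - exact: (continuous_within_halfline f1cw).
  - by move=> n t t0; case: (fnC3 n) => h _; exact: h.
  - by move=> n t t0; case: (fnC3 n) => _ [h _]; apply: dc; exact: h.
have := gt_case phi x0 Ox0 phiC2 ux0 (-1) (or_intror erefl) _ ss.
rewrite mulN1r oppr_le0; apply.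
by move=> x Ox xx0; have := touch x Ox xx0; lra.
Qed.
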